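(* Let $\mathscr{X}$ be a complex Banach space and let $\Psi$ be an elementary operator of length $2$ on $\mathcal{L}(\mathscr{X})$. There exists a nonzero elementary operator $\mathrm{X}$ on $\mathcal{L}(\mathscr{X})$ with $\mathrm{X}\Psi=0$ if and only if one of the following conditions holds. (1) There exists a nonzero multiplication operator $\mathrm{M}$ on $\mathcal{L}(\mathscr{X})$ such that $\mathrm{M}\Psi=0$. (2) There exist an integer $n\ge 2$ and two vector subspaces $\mathscr{U},\mathscr{V}$ of $\mathcal{L}(\mathscr{X})$, each of dimension $n$, such that the space $\{\mathrm{L}_B|_{\mathscr{V}} : B\in \mathsf{R}(\Psi)\}$ is equivalent to a constant rank $n-1$ subspace of $\mathbb{M}_{n-1,n}$ and the space $\{\mathrm{R}_A|_{\mathscr{U}} : A\in \mathsf{L}(\Psi)\}$ is equivalent to a constant rank $n$ subspace of $\mathbb{M}_{n+1,n}$. Moreover, $\mathrm{Rann}(\mathsf{R}(\Psi))=\{0\}$ and $\mathrm{R}_A$ is injective for all $A\in \mathsf{L}(\Psi)\setminus\{0\}$. (3) There exist an integer $n\ge 2$ and two vector subspaces $\mathscr{U},\mathscr{V}$ of $\mathcal{L}(\mathscr{X})$, each of dimension $n$, such that the space $\{\mathrm{L}_B|_{\mathscr{V}} : B\in \mathsf{R}(\Psi)\}$ is equivalent to a constant rank $n$ subspace of $\mathbb{M}_{n+1,n}$ and the space $\{\mathrm{R}_A|_{\mathscr{U}} : A\in \mathsf{L}(\Psi)\}$ is equivalent to a constant rank $n-1$ subspace of $\mathbb{M}_{n-1,n}$.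 Moreover, $\mathrm{Lann}(\mathsf{L}(\Psi))=\{0\}$ and $\mathrm{L}_B$ is injective for all $B\in \mathsf{R}(\Psi)\setminus\{0\}$.
   Context: $\mathcal{L}(\mathscr{X})$ is the algebra of bounded linear operators on $\mathscr{X}$, with identity $I$. For $A,B\in\mathcal{L}(\mathscr{X})$, the multiplication operator $\mathrm{M}_{A,B}$ on $\mathcal{L}(\mathscr{X})$ is $T\mapsto ATB$; $\mathrm{L}_A=\mathrm{M}_{A,I}$ ($T\mapsto AT$) and $\mathrm{R}_B=\mathrm{M}_{I,B}$ ($T\mapsto TB$). An elementary operator on $\mathcal{L}(\mathscr{X})$ is a finite sum of multiplication operators; its length is the minimum number of multiplication operators needed to represent it. Products of elementary operators are compositions. If $\Delta=\sum_{i=1}^n \mathrm{M}_{A_i,B_i}$ has length $n$, then $\mathsf{L}(\Delta)=\mathrm{span}\{A_1,\dots,A_n\}$ and $\mathsf{R}(\Delta)=\mathrm{span}\{B_1,\dots,B_n\}$ (these do not depend on the length-$n$ representation chosen). For $\mathcal{S}\subseteq\mathcal{L}(\mathscr{X})$, $\mathrm{Lann}(\mathcal{S})=\{T\in\mathcal{L}(\mathscr{X}): TS=0 \text{ for all } S\in\mathcal{S}\}$ and $\mathrm{Rann}(\mathcal{S})=\{T\in\mathcal{L}(\mathscr{X}): ST=0\text{ for all }S\in\mathcal{S}\}$. $\mathbb{M}_{m,n}$ is the space of complex $m\times n$ matrices. A linear space of linear maps (or matrices) is of constant rank $r$ if each of its nonzero elements has rank $r$. A linear space $\mathcal{V}$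 of linear maps between finite-dimensional spaces $E$ and $F$ is equivalent to a space of matrices if the latter is the set of matrices of the elements of $\mathcal{V}$ with respect to some fixed basis of $E$ and some fixed basis of $F$. Here $\mathrm{L}_B|_{\mathscr{V}}$ is regarded as a map from $\mathscr{V}$ to $\mathrm{span}\{BF: B\in\mathsf{R}(\Psi), F\in\mathscr{V}\}$, and $\mathrm{R}_A|_{\mathscr{U}}$ as a map from $\mathscr{U}$ to $\mathrm{span}\{EA: A\in\mathsf{L}(\Psi), E\in\mathscr{U}\}$. *)

(* Defs.v *)
From HB Require Import structures.
From mathcomp Require Import all_boot all_order all_algebra.
From mathcomp Require Import complex.
From mathcomp Require Import boolp classical_sets functions reals.
From mathcomp Require Import topology normedtype.

Set Implicit Arguments.
Unset Strict Implicit.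
Unset Printing Implicit Defensive.

Import Order.TTheory GRing.Theory Num.Theory.
Import numFieldNormedType.Exports.

Local Open Scope classical_set_scope.
Local Open Scope ring_scope.

Section LinearAlgebra.
Context {K : fieldType}.
Implicit Types V W : lmodType K.

Definition is_subspace V (S : set V) : Prop :=
  S 0 /\ forall (a : K) (u v : V), S u -> S v -> S (a *: u + v).

Definition lspan V (S : set V) : set V :=
  [set v | exists (n : nat) (c : 'I_n -> K) (s : 'I_n -> V),
     (forall i, S (s i)) /\ v = \sum_(i < n) c i *: s i].

Definition is_basis V n (e : 'I_n -> V) (E : set V) : Prop :=
  (forall c : 'I_n -> K, \sum_(i < n) c i *: e i = 0 -> forall i, c i = 0) /\
  E = lspan (range e).

(* Such an [E] is in particular a vector subspace, being a span. *)
Definition subspace_of_dim V (n : nat) (E : set V) : Prop :=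
  exists e : 'I_n -> V, is_basis e E.

(* Matrices act on columns of coordinates: column [j] of [M] holds the
   coordinates of [phi (e j)] in [f]. *)
Definition is_matrix_of V W p q (e : 'I_q -> V) (f : 'I_p -> W)
    (phi : V -> W) (M : 'M[K]_(p, q)) : Prop :=
  forall j, phi (e j) = \sum_(i < p) M i j *: f i.

(* [Phi] stands for the space of the restrictions [phi|_E : E -> F], for
   [phi] in [Phi]; only the values on [E] of the maps in [Phi] are relevant. *)
Definition equivalent_to_mx V W (E : set V) (F : set W) (Phi : set (V -> W))
    p q (S : set 'M[K]_(p, q)) : Prop :=
  exists (e : 'I_q -> V) (f : 'I_p -> W),
    [/\ is_basis e E, is_basis f F,
        forall phi, Phi phi -> exists2 M, S M & is_matrix_of e f phi M &
        forall M, S M -> exists2 phi, Phi phi & is_matrix_of e f phi M].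

Definition constant_rank p q (r : nat) (S : set 'M[K]_(p, q)) : Prop :=
  forall M, S M -> M != 0 -> \rank M = r.

Definition equivalent_to_constant_rank V W (E : set V) (F : set W)
    (Phi : set (V -> W)) (r p q : nat) : Prop :=
  exists S : set 'M[K]_(p, q),
    [/\ is_subspace S, constant_rank r S & equivalent_to_mx E F Phi S].

End LinearAlgebra.

Section BoundedOperators.
Context {K : numFieldType}.
Variable X : normedModType K.

Definition bounded_linear : {pred X -> X} := fun f =>
  `[< linear f /\ exists M : K, forall x, `|f x| <= M * `|x| >].

Record boundedOp := BoundedOp {
  boundedOp_fun :> X -> X ;
  boundedOpP : boundedOp_fun \in bounded_linear }.

HB.instance Definition _ := [isSub for boundedOp_fun].
HB.instance Definition _ := [Choice of boundedOp by <:].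

Lemma bounded_linear_submod : submod_closed bounded_linear.
Proof.
split=> [|a f g /asboolP[fl [M fM]] /asboolP[gl [N gN]]]; apply/asboolP.
  split=> [b u v|]; first by rewrite /= scaler0 addr0.
  by exists 0 => x; rewrite normr0 mul0r.
split=> [b u v|].
  rewrite !addrfctE !scalrfctE fl gl.
  by rewrite !scalerDr !scalerA (mulrC a b) addrACA.
exists (`|a| * M + N) => x; rewrite addrfctE scalrfctE mulrDl.
by rewrite (le_trans (ler_normD _ _))// lerD// normrZ -mulrA ler_wpM2l.
Qed.

HB.instance Definition _ :=
  GRing.isSubmodClosed.Build K (X -> X) bounded_linear
    (GRing.submod_closed_semi bounded_linear_submod).
HB.instance Definition _ := [SubChoice_isSubLmodule of boundedOp by <:].

Lemma boundedOp_linear (f : boundedOp) : linear f.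
Proof. by have /asboolP[] := boundedOpP f. Qed.

Lemma boundedOp_id_subproof : (id : X -> X) \in bounded_linear.
Proof. by apply/asboolP; split=> //; exists 1 => x; rewrite mul1r. Qed.

Lemma boundedOp_comp_subproof (f g : boundedOp) :
  (f \o g : X -> X) \in bounded_linear.
Proof.
have /asboolP[fl [M fM]] := boundedOpP f.
have /asboolP[gl [N gN]] := boundedOpP g.
apply/asboolP; split=> [a u v /=|]; first by rewrite gl fl.
exists (`|M| * N) => x /=; rewrite (le_trans (fM _))//.
have [->|gx0] := eqVneq (g x) 0.
  rewrite normr0 mulr0 -mulrA mulr_ge0//.
  by rewrite (le_trans _ (gN x)).
have M0 : 0 <= M.
  by rewrite -(pmulr_lge0 _ (_ : 0 < `|g x|)) ?normr_gt0// (le_trans _ (fM _)).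
by rewrite ger0_norm// -mulrA ler_wpM2l.
Qed.

Definition boundedOp_id := BoundedOp boundedOp_id_subproof.
Definition boundedOp_comp (f g : boundedOp) :=
  BoundedOp (boundedOp_comp_subproof f g).

Program Definition boundedOp_ringMixin :=
  @GRing.Zmodule_isPzRing.Build boundedOp boundedOp_id boundedOp_comp
    _ _ _ _ _.
Next Obligation. by move=> f g h; apply/val_inj. Qed.
Next Obligation. by move=> f; apply/val_inj. Qed.
Next Obligation. by move=> f; apply/val_inj. Qed.
Next Obligation. by move=> f g h; apply/val_inj. Qed.
Next Obligation.
move=> f g h; apply/val_inj/funext => x /=.
have /(_ 1 (g x) (h x)) := boundedOp_linear f.
by rewrite !scale1r.
Qed.

(* The product of [boundedOp X] is the composition of operators. *)
HB.instance Definition _ := boundedOp_ringMixin.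

End BoundedOperators.

Section ElementaryOperators.
Context {K : numFieldType} {X : normedModType K}.
Local Notation LX := (boundedOp X).
Implicit Types (A B T : LX) (Phi : LX -> LX) (S : set LX).

Definition mulop A B : LX -> LX := fun T => A * T * B.
Definition lmulop A : LX -> LX := mulop A 1.
Definition rmulop B : LX -> LX := mulop 1 B.

Definition is_mulop Phi : Prop := exists A B, Phi = mulop A B.

Definition sum_mulop n (A B : 'I_n -> LX) : LX -> LX :=
  \sum_(i < n) mulop (A i) (B i).

Definition is_elementary Phi : Prop :=
  exists (n : nat) (A B : 'I_n -> LX), Phi = sum_mulop A B.

Definition has_length Phi (n : nat) : Prop :=
  (exists A B : 'I_n -> LX, Phi = sum_mulop A B) /\
  forall (m : nat) (A B : 'I_m -> LX), Phi = sum_mulop A B -> (n <= m)%N.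

(* The spans of the left, resp. right, coefficients of a representation of
   minimal length; all such representations give the same spans. *)
Definition left_space Phi : set LX :=
  [set T | exists (n : nat) (A B : 'I_n -> LX),
     [/\ has_length Phi n, Phi = sum_mulop A B & lspan (range A) T]].
Definition right_space Phi : set LX :=
  [set T | exists (n : nat) (A B : 'I_n -> LX),
     [/\ has_length Phi n, Phi = sum_mulop A B & lspan (range B) T]].

Definition Lann S : set LX := [set T | forall U, S U -> T * U = 0].
Definition Rann S : set LX := [set T | forall U, S U -> U * T = 0].

End ElementaryOperators.

(* Main.v *)
From HB Require Import structures.
Require Import Defs.
From mathcomp Require Import all_boot all_order all_algebra.
From mathcomp Require Import complex.
From mathcomp Require Import boolp classical_sets functions reals.
From mathcomp Require Import topology normedtype.
From mathcomp Require Import zify ring lra.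

Set Implicit Arguments.
Unset Strict Implicit.
Unset Printing Implicit Defensive.

Import Order.TTheory GRing.Theory Num.Theory.
Local Open Scope classical_set_scope.
Local Open Scope ring_scope.

(**
Write Psi as the sum of T |-> A_0 T B_0 and T |-> A_1 T B_1.  By Hahn-Banach,
L(X) has enough operators of rank one for the map sending a tensor
sum E_j (x) F_j to the elementary operator T |-> sum E_j T F_j to be injective
([mulop_tensor_injective]).  So Chi Psi = 0 is an identity of tensors, and
with f_1, f_2 the right multiplications by A_0, A_1 and g_1, g_2 the left
multiplications by - B_1, B_0 it reads

  sum f_1 E_j (x) g_2 F_j = sum f_2 E_j (x) g_1 F_j.

This form is symmetric under the exchange of f and g.  What remains is linear
algebra of the pencils s f_1 + t f_2 and s g_1 + t g_2, and conditions (2) and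
(3) of the theorem are exchanged by the symmetry ([narrow_wide]).

If (2) or (3) holds, with spaces of dimension n, the tensors supported on them
form a space of dimension n^2 and the relation amounts to
(n - 1) (n + 1) = n^2 - 1 equations: it has a nonzero solution
([narrow_wide_annihilator]).

Conversely, suppose that no multiplication operator kills Psi, so that
s f_1 + t f_2 and s g_1 + t g_2 are never both singular for the same
(s, t) <> 0, and take a solution of minimal length n; then n >= 2.  Its
coefficients E_j and F_j are independent; let U and V be their spans, and y and
z the dimensions of f_1 U + f_2 U and g_1 V + g_2 V.
- A tensor of U (x) V is an n x n matrix N, the given solution being 1.  If N
  is a solution and l an eigenvalue of N, the solution N - l has rank < n,
  hence is 0 by minimality.  The solutions form a line, so n^2 - 1 <= y z
  ([dims_mul]).
- The relation also says that the two maps, of ranks y and z, from and to a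
  space of dimension 2n compose to 0, so y + z <= 2n ([dims_add]).
Together these force (y, z) to be (n - 1, n + 1), (n, n) or (n + 1, n - 1)
([dims_trichotomy]), and y + z = 2n makes the composition above exact.
Exactness carries the kernel of s f_1 + t f_2 on U into that of the transpose
of s g_1 + t g_2 ([kernel_transfer]).  If y = z = n, some s f_1 + t f_2 is
singular on U, and so is s g_1 + t g_2 on V: a contradiction.  If y = n - 1,
every s f_1 + t f_2 is singular, hence every s g_1 + t g_2 is injective, and
kernel_transfer bounds the kernel of s f_1 + t f_2 on U by dimension 1.  This
is (3), and the case y = n + 1 is (2); the clauses on L(X) as a whole, such as
Lann = 0, hold because a pure tensor would be an annihilator otherwise.
*)

(** * Pairs of matrix pencils *)

(** The coordinates of sum f_1 E_j (x) g_2 F_k - sum f_2 E_j (x) g_1 F_k, the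
sums being weighted by N; the rows of a1, a2 (resp. b1, b2) are the images of
the E_j (resp. F_k). *)
Definition pencil_tensor {K : fieldType} {n m p q}
    (a1 a2 : 'M[K]_(n, p)) (b1 b2 : 'M[K]_(m, q)) (N : 'M[K]_(n, m)) :
    'M[K]_(p, q) :=
  a1^T *m N *m b2 - a2^T *m N *m b1.

Lemma pencil_tensor_linear {K : fieldType} {n m p q}
    (a1 a2 : 'M[K]_(n, p)) (b1 b2 : 'M[K]_(m, q)) :
  linear (pencil_tensor a1 a2 b1 b2).
Proof.
move=> c M N; rewrite /pencil_tensor !mulmxDr !mulmxDl -!scalemxAr -!scalemxAl.
by rewrite scalerBr opprD addrACA.
Qed.

HB.instance Definition _ (K : fieldType) n m p q
    (a1 a2 : 'M[K]_(n, p)) (b1 b2 : 'M[K]_(m, q)) :=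
  GRing.isLinear.Build K 'M[K]_(n, m) 'M[K]_(p, q) _
    (pencil_tensor a1 a2 b1 b2) (pencil_tensor_linear a1 a2 b1 b2).

Lemma lin_ker_rank_ge {K : fieldType} {m n p q}
    (f : {linear 'M[K]_(m, n) -> 'M[K]_(p, q)}) :
  (m * n - p * q <= \rank (kermx (lin_mx f)))%N.
Proof. by rewrite mxrank_ker leq_sub2l// rank_leq_col. Qed.

Lemma lin_ker_sub_line {K : fieldType} {m n p q}
    (f : {linear 'M[K]_(m, n) -> 'M[K]_(p, q)}) (M0 : 'M[K]_(m, n)) :
  (forall M, f M = 0 -> exists c, M = c *: M0) -> (m * n - p * q <= 1)%N.
Proof.
move=> kerf; apply: leq_trans (lin_ker_rank_ge f) _.
apply: leq_trans (rank_leq_row (mxvec M0)); apply: mxrankS.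
apply/row_subP => i; have /sub_kermxP := row_sub i (kermx (lin_mx f)).
rewrite mul_rV_lin => /(congr1 vec_mx); rewrite mxvecK linear0 => /kerf[c Mc].
by rewrite -[row i _]vec_mxK Mc linearZ scalemx_sub.
Qed.

Lemma lin_ker_neq0 {K : fieldType} {m n p q}
    (f : {linear 'M[K]_(m, n) -> 'M[K]_(p, q)}) :
  (p * q < m * n)%N -> exists2 M, M != 0 & f M = 0.
Proof.
move=> lt_pq; have : kermx (lin_mx f) != 0.
  by rewrite -mxrank_eq0 -lt0n (leq_trans _ (lin_ker_rank_ge f))// subn_gt0.
move=> /rowV0Pn[v /sub_kermxP vf v0]; exists (vec_mx v).
  by apply: contra_neq v0 => /(congr1 mxvec); rewrite vec_mxK linear0.
by move: vf; rewrite mul_rV_lin => /(congr1 vec_mx); rewrite mxvecK linear0.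
Qed.

Lemma row_kernel_neq0 {K : fieldType} {n p} (M : 'M[K]_(n, p)) :
  (\rank M < n)%N ->
  exists2 u : 'rV_n, u != 0 & u *m M = 0.
Proof.
move=> Mn; have : kermx M != 0 by rewrite kermx_eq0 -row_leq_rank -ltnNge.
by move=> /rowV0Pn[u /sub_kermxP uM u0]; exists u.
Qed.

(** The determinant of s a1 + t a2 is a binary form, which has a nontrivial zero
over an algebraically closed field. *)
Lemma singular_pencil {C : numClosedFieldType} {n} (a1 a2 : 'M[C]_n) :
  (0 < n)%N -> exists s t : C, (s != 0) || (t != 0) /\
    (\rank (s *: a1 + t *: a2)%R < n)%N.
Proof.
move=> n0; have [a2u|a2N] := boolP (a2 \in unitmx); last first.
  exists 0, 1; rewrite oner_neq0 orbT scale0r scale1r add0r; split=> //.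
  by rewrite ltn_neqAle rank_leq_row andbT; move: a2N; rewrite -row_free_unit.
have [l /eigenvalueP[v vl v0]] := eigenvalue_closed (a1 *m invmx a2) n0.
exists 1, (- l); rewrite oner_neq0; split => //.
rewrite ltn_neqAle rank_leq_row andbT; apply: contra_neqN v0 => fr.
apply: (row_free_inj fr); rewrite mul0mx mulmxDr -!scalemxAr scale1r scaleNr.
by rewrite scalemxAl -vl !mulmxA mulmxKV// subrr.
Qed.

(** The rows of a1, a2 and b1, b2 are the coordinates of the images of the two
coefficient families of an annihilator of minimal length n, in bases of the
spaces spanned by these images, whence the full ranks; the annihilator itself
has matrix 1.  Minimality becomes [rel_unit]: a singular N would give a shorter
annihilator. *)
Section Pencils.
Context {C : numClosedFieldType} {n y z : nat}.
Variables (a1 a2 : 'M[C]_(n, y)) (b1 b2 : 'M[C]_(n, z)).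
Hypothesis n_ge2 : (2 <= n)%N.
Hypothesis a_full : row_full (col_mx a1 a2).
Hypothesis b_full : row_full (col_mx b1 b2).
Hypothesis rel1 : pencil_tensor a1 a2 b1 b2 1%:M = 0.
Hypothesis rel_unit :
  forall N : 'M_n, N != 0 -> pencil_tensor a1 a2 b1 b2 N = 0 -> N \in unitmx.
Hypothesis no_common_kernel : forall (s t : C) (u v : 'rV_n),
  (s != 0) || (t != 0) ->
  u *m (s *: a1 + t *: a2) = 0 -> v *m (s *: b1 + t *: b2) = 0 ->
  u = 0 \/ v = 0.

(* The swap and the sign turn the relation satisfied by 1 into a product. *)
Let alpha := col_mx a1 a2.
Let beta := col_mx b2 (- b1).

Lemma beta_full : row_full beta.
Proof.
move/row_fullP: b_full => [D]; rewrite -[D]hsubmxK mul_row_col => DE.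
apply/row_fullP; exists (row_mx (rsubmx D) (- lsubmx D)).
by rewrite mul_row_col mulmxN mulNmx opprK addrC.
Qed.

Lemma alpha_beta : alpha^T *m beta = 0.
Proof.
by rewrite tr_col_mx mul_row_col mulmxN -rel1 /pencil_tensor !mulmx1.
Qed.

Lemma dims_add : (y + z <= n + n)%N.
Proof.
have := mulmx0_rank_max alpha_beta; rewrite mxrank_tr.
by move: a_full beta_full; rewrite /row_full => /eqP-> /eqP->.
Qed.

(** If l is an eigenvalue of N, then N - l also satisfies the relation and is
singular. *)
Lemma relations_scalar (N : 'M_n) : pencil_tensor a1 a2 b1 b2 N = 0 ->
  exists c, N = c *: 1%:M.
Proof.
move=> relN; have n0 : (0 < n)%N by exact: leq_trans n_ge2.
have [l /eigenvalueP[v vl v0]] := eigenvalue_closed N n0; exists l.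
apply/eqP; rewrite -subr_eq0; apply: contraNT v0 => /rel_unit.
rewrite linearB linearZ /= relN rel1 scaler0 subrr => /(_ erefl) Nu.
apply/eqP; rewrite -(mulmxK Nu v) mulmxBr vl -scalemxAr mulmx1.
by rewrite subrr mul0mx.
Qed.

Lemma dims_mul : (n * n <= y * z + 1)%N.
Proof.
have := lin_ker_sub_line (f := pencil_tensor a1 a2 b1 b2) relations_scalar.
by rewrite leq_subLR addnC => ->.
Qed.

(** With y = n - d, the inequality y + z <= 2n bounds y z by n^2 - d^2, so
d^2 <= 1; and y + z < 2n would give y z <= n (n - 1) < n^2 - 1. *)
Lemma dims_trichotomy : [\/ (y = n - 1 /\ z = n + 1)%N, (y = n /\ z = n)%N
  | (y = n + 1 /\ z = n - 1)%N].
Proof.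
have s := dims_add; have p := dims_mul.
have [yn|ny] := leqP y n.
  have [d nE] : exists d, n = (y + d)%N by exists (n - y)%N; lia.
  have d1 : (d <= 1)%N by rewrite leqNgt; apply/negP => d2; nia.
  case: d d1 nE => [|[]]// _ nE; [apply: Or32|apply: Or31]; nia.
have [d nE] : exists d, n = (z + d)%N by exists (n - z)%N; lia.
have d1 : (d <= 1)%N by rewrite leqNgt; apply/negP => d2; nia.
by case: d d1 nE => [|[]]// _ nE; apply: Or33; nia.
Qed.

(** When y + z = 2n, the row space of beta^T is the whole left kernel of alpha.
If u (s a1 + t a2) = 0, then (s u, t u) is in that kernel, so it is
(w b2^T, - w b1^T) for some w, and w (s b1 + t b2)^T = 0; the map from u to w
is injective because (s, t) is not zero. *)
Lemma kernel_transfer (s t : C) : (y + z = n + n)%N -> (s != 0) || (t != 0) ->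
  (n - \rank (s *: a1 + t *: a2)%R <= z - \rank (s *: b1 + t *: b2)%R)%N.
Proof.
move=> yz st; set k := kermx (s *: a1 + t *: a2).
have kers : (beta^T == kermx alpha)%MS.
  have sub : (beta^T <= kermx alpha)%MS.
    apply/sub_kermxP; apply: (can_inj trmxK).
    by rewrite trmx_mul trmxK trmx0 alpha_beta.
  rewrite -(mxrank_leqif_eq sub) mxrank_tr mxrank_ker.
  move: a_full beta_full; rewrite /row_full => /eqP-> /eqP->.
  by apply/eqP; lia.
have [D kD] : exists D, row_mx (s *: k) (t *: k) = D *m beta^T.
  apply/submxP; rewrite (eqmxP kers); apply/sub_kermxP.
  rewrite mul_row_col -!scalemxAl !scalemxAr -mulmxDr.
  exact: mulmx_ker.
have [kD1 kD2] : s *: k = D *m b2^T /\ t *: k = - (D *m b1^T).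
  move: kD; rewrite tr_col_mx mul_mx_row => /eq_row_mx[-> ->].
  by rewrite linearN mulmxN.
have D0 : (D <= kermx (s *: b1 + t *: b2)^T)%MS.
  apply/sub_kermxP; rewrite linearD !linearZ/= mulmxDr -!scalemxAr -kD1.
  by rewrite -[D *m b1^T]opprK -kD2 scalerN !scalerA mulrC addNr.
rewrite -mxrank_ker -/k; apply: (@leq_trans (\rank D)); last first.
  by rewrite (leq_trans (mxrankS D0))// mxrank_ker mxrank_tr.
case/orP: st => [s0|t0].
  have -> : k = s^-1 *: (D *m b2^T) by rewrite -kD1 scalerA mulVf// scale1r.
  by rewrite scalemxAl (leq_trans (mxrankM_maxl _ _))// mxrank_scale.
have -> : k = - t^-1 *: (D *m b1^T).
  by rewrite scaleNr -scalerN -kD2 scalerA mulVf// scale1r.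
by rewrite scalemxAl (leq_trans (mxrankM_maxl _ _))// mxrank_scale.
Qed.

Lemma no_common_rank_drop (s t : C) : (s != 0) || (t != 0) ->
  (\rank (s *: a1 + t *: a2)%R < n)%N -> \rank (s *: b1 + t *: b2)%R = n.
Proof.
move=> st /row_kernel_neq0[u /eqP u0 ua].
apply/eqP; rewrite eqn_leq rank_leq_row leqNgt; apply/negP.
move=> /row_kernel_neq0[v /eqP v0 vb].
by case: (no_common_kernel st ua vb).
Qed.

Lemma square_pencils_excluded : y = n -> z = n -> False.
Proof.
move=> yn zn.
have n0 : (0 < n)%N by exact: leq_trans n_ge2.
have sing p (c1 c2 : 'M[C]_(n, p)) : p = n -> exists s t : C,
    (s != 0) || (t != 0) /\ (\rank (s *: c1 + t *: c2)%R < n)%N.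
  by move=> pn; subst p; exact: singular_pencil.
have [s [t [st ra]]] := sing _ a1 a2 yn.
have /kernel_transfer : (y + z = n + n)%N by lia.
by move=> /(_ s t st); rewrite (no_common_rank_drop st ra); lia.
Qed.

(** Each s a1 + t a2 has a kernel for want of columns, so s b1 + t b2 has none;
then [kernel_transfer] bounds the first kernel by dimension 1. *)
Lemma narrow_pencil_ranks : y = (n - 1)%N -> z = (n + 1)%N ->
  forall s t : C, (s != 0) || (t != 0) ->
  \rank (s *: a1 + t *: a2)%R = (n - 1)%N /\
  \rank (s *: b1 + t *: b2)%R = n.
Proof.
move=> yn zn s t st.
have ray : (\rank (s *: a1 + t *: a2)%R <= n - 1)%N.
  by rewrite (leq_trans (rank_leq_col _))// yn.
have rb : \rank (s *: b1 + t *: b2)%R = n.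
  by apply: no_common_rank_drop => //; lia.
split=> //; have /kernel_transfer : (y + z = n + n)%N by lia.
by move=> /(_ s t st); rewrite rb; lia.
Qed.

End Pencils.

(** * Finite families and their tensors *)

Section Families.
Context {K : fieldType} {W : lmodType K}.

Definition lin_indep {n} (e : 'I_n -> W) : Prop :=
  forall c : 'I_n -> K, \sum_(i < n) c i *: e i = 0 -> forall i, c i = 0.

Definition lincomb {m n} (M : 'M[K]_(m, n)) (e : 'I_n -> W) : 'I_m -> W :=
  fun i => \sum_(j < n) M i j *: e j.

Lemma lincombA {m n p} (M : 'M_(m, n)) (N : 'M_(n, p)) (e : 'I_p -> W) :
  lincomb M (lincomb N e) = lincomb (M *m N) e.
Proof.
apply/funext => i; rewrite /lincomb.
under eq_bigr do rewrite scaler_sumr; rewrite exchange_big/=.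
apply: eq_bigr => k _; rewrite mxE scaler_suml.
by apply: eq_bigr => j _; rewrite scalerA.
Qed.

Lemma lincomb1 {n} (e : 'I_n -> W) : lincomb 1%:M e = e.
Proof.
apply/funext => i; rewrite /lincomb (bigD1 i)//= mxE eqxx scale1r big1 ?addr0//.
by move=> j ji; rewrite mxE eq_sym (negPf ji) scale0r.
Qed.

Lemma lincombDl {m n} (s t : K) (M N : 'M_(m, n)) (e : 'I_n -> W) i :
  lincomb (s *: M + t *: N) e i = s *: lincomb M e i + t *: lincomb N e i.
Proof.
rewrite /lincomb !scaler_sumr -big_split/=; apply: eq_bigr => j _.
by rewrite !mxE scalerDl !scalerA.
Qed.

Lemma lincomb0l {m n} (e : 'I_n -> W) (i : 'I_m) : lincomb 0 e i = 0.
Proof. by rewrite /lincomb big1// => j _; rewrite mxE scale0r. Qed.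

Lemma lin_indep_row {n} (e : 'I_n -> W) : lin_indep e ->
  forall u : 'rV_n, lincomb u e 0 = 0 -> u = 0.
Proof.
by move=> ie u /ie u0; apply/rowP => j; rewrite mxE; exact: u0.
Qed.

Lemma lin_indep_neq0 {n} (e : 'I_n -> W) i : lin_indep e -> e i <> 0.
Proof.
move=> ie ei0; have e0 : \sum_(j < n) (j == i)%:R *: e j = 0.
  rewrite (bigD1 i)//= ei0 scaler0 add0r big1// => j /negPf->.
  by rewrite scale0r.
by have /eqP := ie _ e0 i; rewrite eqxx oner_eq0.
Qed.

Lemma lin_indep1 (x : W) : x <> 0 -> lin_indep (fun _ : 'I_1 => x).
Proof.
move=> /eqP x0 c; rewrite big_ord1 => /eqP; rewrite scaler_eq0 (negPf x0) orbF.
by move=> /eqP c0 i; rewrite ord1.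
Qed.

(** This is the form in which a linear relation shortens a tensor: the family is
unchanged by a singular matrix, which can be moved to the other factor. *)
Lemma lin_dep_rank_drop {n} (e : 'I_n -> W) : ~ lin_indep e ->
  exists2 Q : 'M[K]_n, (\rank Q < n)%N & e = lincomb Q e.
Proof.
move=> /existsNP[c] /not_implyP[ce /existsNP[k /eqP ck]].
pose u := \row_j c j; pose d := delta_mx k 0 *m ((c k)^-1 *: u).
have ue : lincomb u e = fun=> 0.
  by apply/funext => i; rewrite -[RHS]ce; apply: eq_bigr => j _; rewrite mxE.
(* The relation lets 1 - d fix e, and u (1 - d) = 0. *)
exists (1%:M - d).
  rewrite ltn_neqAle rank_leq_row andbT; apply/negP => fr.
  have u0 : u = 0.
    apply: (row_free_inj fr); rewrite mul0mx mulmxBr mulmx1 mulmxA.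
    rewrite -colE; apply/rowP => j; rewrite !mxE big_ord1 !mxE.
    by rewrite mulrA mulfV// mul1r subrr.
  by have /rowP/(_ k) := u0; rewrite !mxE; exact/eqP.
apply/funext => i; rewrite -[1%:M]scale1r -scaleN1r lincombDl lincomb1 scale1r.
rewrite -lincombA.
have -> : lincomb ((c k)^-1 *: u) e = fun=> 0.
  apply/funext => j; have /(congr1 (@^~ j)) := ue.
  rewrite /lincomb; under [in X in _ -> X = _]eq_bigr do rewrite mxE -scalerA.
  by rewrite -scaler_sumr => ->; rewrite scaler0.
by rewrite /lincomb big1 ?scaler0 ?addr0// => j _; rewrite scaler0.
Qed.

Lemma lincomb_factor {m n} (M : 'M_(m, n)) (e : 'I_n -> W) :
  lincomb M e = lincomb (col_base M) (lincomb (row_base M) e).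
Proof. by rewrite lincombA mulmx_base. Qed.

(** Of all expressions of g through a family h, one with h as short as possible:
a dependent h or a coefficient matrix of smaller rank would give a shorter
one. *)
Lemma exists_basis {m} (g : 'I_m -> W) :
  exists p (h : 'I_p -> W) (a : 'M_(m, p)),
  [/\ lin_indep h, row_full a & g = lincomb a h].
Proof.
pose P p := `[< exists (h : 'I_p -> W) (a : 'M_(m, p)), g = lincomb a h >].
have exP : exists p, P p.
  by exists m; apply/asboolP; exists g, 1%:M; rewrite lincomb1.
case: (ex_minnP exP) => p /asboolP[h [a ga]] minp.
have le_rank (h' : 'I_p -> W) (M : 'M_(m, p)) :
    g = lincomb M h' -> (p <= \rank M)%N.
  move=> gM; apply: minp; apply/asboolP.
  by exists (lincomb (row_base M) h'), (col_base M); rewrite -lincomb_factor.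
exists p, h, a; split=> //.
  apply: contrapT => /lin_dep_rank_drop[Q Qp hQ].
  have /le_rank : g = lincomb (a *m Q) h by rewrite -lincombA -hQ.
  by rewrite leqNgt (leq_ltn_trans (mxrankM_maxr _ _) Qp).
by rewrite /row_full eqn_leq rank_leq_col (le_rank h).
Qed.

Lemma exists_basis2 {m n} (g1 : 'I_m -> W) (g2 : 'I_n -> W) :
  exists p (h : 'I_p -> W) (a1 : 'M_(m, p)) (a2 : 'M_(n, p)),
  [/\ lin_indep h, row_full (col_mx a1 a2), g1 = lincomb a1 h
    & g2 = lincomb a2 h].
Proof.
have [p [h [a [ih fa ga]]]] :=
  exists_basis (fun i : 'I_(m + n) =>
    match fintype.split i with inl j => g1 j | inr j => g2 j end).
exists p, h, (usubmx a), (dsubmx a); split; rewrite ?vsubmxK//;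
  apply/funext => i.
- have /(congr1 (@^~ (lshift n i)))/= := ga.
  rewrite (unsplitK (inl i : 'I_m + 'I_n)%type) => ->.
  by apply: eq_bigr => j _; rewrite mxE.
have /(congr1 (@^~ (rshift m i)))/= := ga.
rewrite (unsplitK (inr i : 'I_m + 'I_n)%type) => ->.
by apply: eq_bigr => j _; rewrite mxE.
Qed.

End Families.

Lemma linear_lincomb {K : fieldType} {V W : lmodType K} (f : {linear V -> W})
    {m n} (M : 'M_(m, n)) (e : 'I_n -> V) :
  f \o lincomb M e = lincomb M (f \o e).
Proof.
apply/funext => i /=; rewrite /lincomb linear_sum.
by apply: eq_bigr => j _; rewrite linearZ.
Qed.

Lemma linear_fun0 {K : fieldType} {V W : lmodType K} (f : V -> W) :
  linear f -> f 0 = 0.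
Proof. by move=> /(_ (-1) 0 0); rewrite scaler0 addr0 scaleN1r addNr. Qed.

Lemma linear_funZ {K : fieldType} {V W : lmodType K} (f : V -> W) :
  linear f -> forall c x, f (c *: x) = c *: f x.
Proof.
by move=> fl c x; have := fl c x 0; rewrite !addr0 (linear_fun0 fl) addr0.
Qed.

Section Tensors.
Context {K : fieldType} {W1 W2 W3 : lmodType K} (mu : W1 -> W2 -> W3).

(** The image under mu of the tensor of matrix M in the families e and f. *)
Definition tens {m n} (M : 'M[K]_(m, n)) (e : 'I_m -> W1)
    (f : 'I_n -> W2) : W3 :=
  \sum_(i < m) \sum_(j < n) M i j *: mu (e i) (f j).

(** Injectivity on the algebraic tensor product of the linear map induced by
mu. *)
Definition tensor_injective : Prop :=
  forall m n (M : 'M[K]_(m, n)) (e : 'I_m -> W1) (f : 'I_n -> W2),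
  lin_indep e -> lin_indep f -> tens M e f = 0 -> M = 0.

Lemma tens1 {n} (e : 'I_n -> W1) (f : 'I_n -> W2) :
  tens 1%:M e f = \sum_(i < n) mu (e i) (f i).
Proof.
apply: eq_bigr => i _; rewrite (bigD1 i)//= mxE eqxx scale1r big1 ?addr0//.
by move=> j ji; rewrite mxE eq_sym (negPf ji) scale0r.
Qed.

Lemma tensB {m n} (M N : 'M_(m, n)) e f :
  tens (M - N) e f = tens M e f - tens N e f.
Proof.
rewrite /tens -sumrB; apply: eq_bigr => i _; rewrite -sumrB.
by apply: eq_bigr => j _; rewrite !mxE scalerBl.
Qed.

Hypothesis mul : forall y, linear (mu^~ y).
Hypothesis mur : forall x, linear (mu x).

Lemma tens_lincombl {m n p} (M : 'M_(m, n)) (P : 'M_(m, p)) e f :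
  tens M (lincomb P e) f = tens (P^T *m M) e f.
Proof.
have mu0 y : mu 0 y = 0 by exact: linear_fun0 (mul y).
have mus i y : mu (lincomb P e i) y = \sum_k P i k *: mu (e k) y.
  by rewrite /lincomb; elim/big_rec2: _ => [|k u v _ <-]; rewrite ?mul ?mu0.
rewrite /tens.
under eq_bigr do under eq_bigr do rewrite mus scaler_sumr.
under eq_bigr do rewrite exchange_big/=.
rewrite exchange_big/=; apply: eq_bigr => k _.
rewrite exchange_big/=; apply: eq_bigr => j _.
rewrite mxE scaler_suml; apply: eq_bigr => i _.
by rewrite scalerA mxE mulrC.
Qed.

End Tensors.

Lemma tens_flip {K : fieldType} {W1 W2 W3 : lmodType K} (mu : W1 -> W2 -> W3)
    {m n} (M : 'M_(m, n)) e f :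
  tens (fun y x => mu x y) M^T f e = tens mu M e f.
Proof.
rewrite /tens exchange_big; apply: eq_bigr => i _; apply: eq_bigr => j _.
by rewrite mxE.
Qed.

Lemma tensor_injective_flip {K : fieldType} {W1 W2 W3 : lmodType K}
    (mu : W1 -> W2 -> W3) :
  tensor_injective mu -> tensor_injective (fun y x => mu x y).
Proof.
move=> muI m n M f e jf je; rewrite -[M]trmxK tens_flip => /muI M0.
by rewrite [M^T]M0// trmx0.
Qed.

Section BilinearTensors.
Context {K : fieldType} {W1 W2 W3 : lmodType K} (mu : W1 -> W2 -> W3).
Hypothesis mul : forall y, linear (mu^~ y).
Hypothesis mur : forall x, linear (mu x).

Lemma tens_lincombr {m n p} (M : 'M_(m, n)) (Q : 'M_(n, p)) e f :
  tens mu M e (lincomb Q f) = tens mu (M *m Q) e f.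
Proof. by rewrite -tens_flip tens_lincombl// -trmx_mul tens_flip. Qed.

Lemma tens_lincomb {m n p q} (M : 'M_(m, n)) (P : 'M_(m, p)) (Q : 'M_(n, q))
    e f :
  tens mu M (lincomb P e) (lincomb Q f) = tens mu (P^T *m M *m Q) e f.
Proof. by rewrite tens_lincombl// tens_lincombr. Qed.

(** A tensor is a sum of as many pure tensors as the rank of its matrix. *)
Lemma tens_factor {m n} (M : 'M_(m, n)) e f :
  tens mu M e f =
  tens mu 1%:M (lincomb (col_base M)^T e) (lincomb (row_base M) f).
Proof. by rewrite tens_lincomb trmxK mulmx1 mulmx_base. Qed.

End BilinearTensors.

(** * Pencils of linear maps *)

Section LinearPencils.
Context {K : fieldType} {V W : lmodType K}.

Definition pencil (f1 f2 : V -> W) : set (V -> W) :=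
  [set f | exists s t : K, f = fun x => s *: f1 x + t *: f2 x].

Definition pencil_image (f1 f2 : V -> W) (E : set V) : set W :=
  lspan [set f x | f in pencil f1 f2 & x in E].

Lemma lspan_mem (S : set V) x : S x -> lspan S x.
Proof.
move=> Sx; exists 1%N, (fun=> 1), (fun=> x); split=> //.
by rewrite big_ord1 scale1r.
Qed.

Lemma lspan_mono (S T : set V) : S `<=` T -> lspan S `<=` lspan T.
Proof.
by move=> ST _ [n [c [s [sS ->]]]]; exists n, c, s; split=> // i; exact: ST.
Qed.

Lemma lspan_range {n} (e : 'I_n -> V) x :
  lspan (range e) x <-> exists u : 'rV_n, x = lincomb u e 0.
Proof.
split=> [[k [c [s [se ->]]]]|[u ->]]; last first.
  by exists n, (u 0), e; split=> // i; exists i.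
have [j je] : exists j : 'I_k -> 'I_n, forall i, s i = e (j i).
  have /choice[j je] : forall i, exists j, s i = e j.
    by move=> i; have [j _ <-] := se i; exists j.
  by exists j.
exists (\row_i (c i) *m \matrix_(i, l) (j i == l)%:R).
rewrite -lincombA /lincomb; apply: eq_bigr => i _.
rewrite mxE je (bigD1 (j i))//= mxE eqxx scale1r big1 ?addr0// => l li.
by rewrite mxE eq_sym (negPf li) scale0r.
Qed.

Lemma lspan_range2 (e : 'I_2 -> V) x :
  lspan (range e) x <-> exists s t : K, x = s *: e 0 + t *: e 1.
Proof.
rewrite lspan_range; split=> [[u ->]|[s [t ->]]].
  exists (u 0 0), (u 0 1); rewrite /lincomb big_ord_recl big_ord1.
  by congr (_ + u 0 _ *: e _); apply/val_inj.
exists (\row_i (if i == 0 then s else t)).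
rewrite /lincomb big_ord_recl big_ord1 !mxE/=.
by congr (_ + _ *: e _); apply/val_inj.
Qed.

Lemma lspan_idem {n} (e : 'I_n -> V) (S : set V) :
  S `<=` lspan (range e) -> lspan S `<=` lspan (range e).
Proof.
move=> Se x [k [c [s [sS ->]]]]; apply/lspan_range.
have /choice[u ue] : forall i, exists u : 'rV_n, s i = lincomb u e 0.
  by move=> i; have /Se/lspan_range[u ->] := sS i; exists u.
exists (\row_i c i *m \matrix_(i, j) u i 0 j); rewrite -lincombA /lincomb.
apply: eq_bigr => i _; rewrite mxE ue; congr (_ *: _).
by apply: eq_bigr => j _; rewrite mxE.
Qed.

End LinearPencils.

Lemma lspan_lincomb {K : fieldType} {V : lmodType K} {m n} (M : 'M_(m, n))
    (e : 'I_n -> V) : lspan (range (lincomb M e)) `<=` lspan (range e).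
Proof.
apply: lspan_idem => _ [i _ <-]; apply/lspan_range; exists (row i M).
by apply: eq_bigr => j _; rewrite mxE.
Qed.

Lemma lincomb_pencil {K : fieldType} {V W : lmodType K}
    (f1 f2 : {linear V -> W})
    {n p} (e : 'I_n -> V) (h : 'I_p -> W) (a1 a2 : 'M_(n, p)) (s t : K) m
    (M : 'M_(m, n)) i :
  f1 \o e = lincomb a1 h -> f2 \o e = lincomb a2 h ->
  s *: f1 (lincomb M e i) + t *: f2 (lincomb M e i) =
  lincomb (M *m (s *: a1 + t *: a2)) h i.
Proof.
move=> e1 e2; rewrite mulmxDr -!scalemxAr lincombDl -!lincombA -e1 -e2.
by rewrite -!linear_lincomb.
Qed.

(** The full rank of (a1, a2) makes h a basis of the image of the pencil, and
not just of a larger space, as the definition of equivalence requires. *)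
Lemma pencil_constant_rank {K : fieldType} {V W : lmodType K}
    (f1 f2 : {linear V -> W}) {n p r : nat} (e : 'I_n -> V) (h : 'I_p -> W)
    (a1 a2 : 'M_(n, p)) :
  lin_indep e -> lin_indep h -> row_full (col_mx a1 a2) ->
  f1 \o e = lincomb a1 h -> f2 \o e = lincomb a2 h ->
  (forall s t : K, (s != 0) || (t != 0) -> \rank (s *: a1 + t *: a2)%R = r) ->
  equivalent_to_constant_rank (lspan (range e))
    (pencil_image f1 f2 (lspan (range e))) (pencil f1 f2) r p n.
Proof.
move=> ie ih fa e1 e2 ra.
have mxf s t j : s *: f1 (e j) + t *: f2 (e j) =
    \sum_(i < p) (s *: a1 + t *: a2)^T i j *: h i.
  rewrite -[in LHS](lincomb1 e) (lincomb_pencil _ _ _ _ e1 e2).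
  by rewrite mul1mx; apply: eq_bigr => i _; rewrite [in RHS]mxE.
exists [set (s *: a1 + t *: a2)^T | s in setT & t in setT]; split.
- split=> [|c _ _ [s _ [t _ <-]] [s' _ [t' _ <-]]].
    by exists 0 => //; exists 0 => //; rewrite !scale0r addr0 trmx0.
  exists (c * s + s') => //; exists (c * t + t') => //.
  rewrite -linearZ -linearD/=; congr (_^T).
  by rewrite scalerDr !scalerA addrACA -!scalerDl.
- move=> _ [s _ [t _ <-]] st0; rewrite mxrank_tr; apply: ra.
  apply: contraNT st0; rewrite negb_or !negbK => /andP[/eqP-> /eqP->].
  by rewrite !scale0r addr0 trmx0.
exists e, h; split.
- by split.
- split=> //; apply/seteqP; split.
    apply: lspan_idem => _ [_ [s [t ->]] [x /lspan_range[u ->] <-]].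
    apply/lspan_range; exists (u *m (s *: a1 + t *: a2)).
    by rewrite (lincomb_pencil _ _ _ _ e1 e2).
  have /row_fullP[D DE] := fa.
  rewrite -[h in lspan (range h)]lincomb1 -DE -lincombA.
  apply: subset_trans (@lspan_lincomb _ _ _ _ _ _) (lspan_mono _) => _ [k _ <-].
  case: (split_ordP k) => j ->.
    exists (fun x => 1 *: f1 x + 0 *: f2 x); first by exists 1, 0.
    exists (e j); first by apply: lspan_mem; exists j.
    rewrite scale1r scale0r addr0 -[LHS]/((f1 \o e) j) e1.
    by apply: eq_bigr => i _; rewrite col_mxEu.
  exists (fun x => 0 *: f1 x + 1 *: f2 x); first by exists 0, 1.
  exists (e j); first by apply: lspan_mem; exists j.
  rewrite scale1r scale0r add0r -[LHS]/((f2 \o e) j) e2.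
  by apply: eq_bigr => i _; rewrite col_mxEd.
- move=> _ [s [t ->]]; exists (s *: a1 + t *: a2)^T.
    by exists s => //; exists t.
  by move=> j; exact: mxf.
- move=> _ [s _ [t _ <-]]; exists (fun x => s *: f1 x + t *: f2 x).
    by exists s, t.
  by move=> j; exact: mxf.
Qed.

Lemma constant_rank_coordinates {K : fieldType} {V W : lmodType K}
    (f1 f2 : V -> W) {r p n : nat} (E : set V) (F : set W) :
  equivalent_to_constant_rank E F (pencil f1 f2) r p n ->
  exists (e : 'I_n -> V) (h : 'I_p -> W) (a1 a2 : 'M_(n, p)),
  [/\ lin_indep e, lin_indep h, f1 \o e = lincomb a1 h
    & f2 \o e = lincomb a2 h].
Proof.
move=> [S [_ _ [e [h [[ie _] [ih _] toS _]]]]].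
have coord s t : exists a : 'M_(n, p),
    (fun x => s *: f1 x + t *: f2 x) \o e = lincomb a h.
  have [|M _ Mf] := toS (fun x => s *: f1 x + t *: f2 x); first by exists s, t.
  exists M^T; apply/funext => j; rewrite [LHS]/= Mf.
  by apply: eq_bigr => i _; rewrite mxE.
have [a1 e1] := coord 1 0; have [a2 e2] := coord 0 1.
exists e, h, a1, a2; split=> //; rewrite -?e1 -?e2; apply/funext => x /=.
  by rewrite scale1r scale0r addr0.
by rewrite scale1r scale0r add0r.
Qed.

(** * Annihilators of length two tensors *)

(** For f1, f2 the right multiplications by A_0, A_1 and g1, g2 the left
multiplications by - B_1, B_0, the tensor of matrix N annihilates
A_0 (x) B_0 + A_1 (x) B_1.  The sign is put in g1 so that exchanging the two
factors only reverses the equality. *)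
Definition annihilates {K : fieldType} {W1 W2 W3 : lmodType K}
    (mu : W1 -> W2 -> W3) (f1 f2 : W1 -> W1) (g1 g2 : W2 -> W2) {m n}
    (N : 'M_(m, n)) (e : 'I_m -> W1) (h : 'I_n -> W2) : Prop :=
  tens mu N (f1 \o e) (g2 \o h) = tens mu N (f2 \o e) (g1 \o h).

Definition narrow_wide_spaces {K : fieldType} {V W : lmodType K}
    (f1 f2 : V -> V) (g1 g2 : W -> W) : Prop :=
  exists n (U : set V) (U' : set W),
  [/\ (2 <= n)%N, subspace_of_dim n U, subspace_of_dim n U',
      equivalent_to_constant_rank U (pencil_image f1 f2 U) (pencil f1 f2)
        (n - 1) (n - 1) n
    & equivalent_to_constant_rank U' (pencil_image g1 g2 U') (pencil g1 g2)
        n (n + 1) n].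

(** Condition (3) of the theorem for these f and g, and condition (2) with f and
g exchanged. *)
Definition narrow_wide {K : fieldType} {V W : lmodType K}
    (f1 f2 : V -> V) (g1 g2 : W -> W) : Prop :=
  [/\ narrow_wide_spaces f1 f2 g1 g2,
      (forall x, f1 x = 0 -> f2 x = 0 -> x = 0)
    & (forall s t : K, (s != 0) || (t != 0) ->
        forall y, s *: g1 y + t *: g2 y = 0 -> y = 0)].

Section BilinearPencils.
Context {K : fieldType} {W1 W2 W3 : lmodType K} (mu : W1 -> W2 -> W3).
Hypothesis mul : forall y, linear (mu^~ y).
Hypothesis mur : forall x, linear (mu x).
Variables (f1 f2 : {linear W1 -> W1}) (g1 g2 : {linear W2 -> W2}).

Lemma annihilates_flip {m n} (N : 'M_(m, n)) e h :
  annihilates mu f1 f2 g1 g2 N e h <->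
  annihilates (fun y x => mu x y) g1 g2 f1 f2 N^T h e.
Proof. by rewrite /annihilates !tens_flip; split. Qed.

Lemma annihilates_lincomb {m n p q} (N : 'M_(m, n)) (P : 'M_(m, p))
    (Q : 'M_(n, q)) e h :
  annihilates mu f1 f2 g1 g2 N (lincomb P e) (lincomb Q h) <->
  annihilates mu f1 f2 g1 g2 (P^T *m N *m Q) e h.
Proof. by rewrite /annihilates !linear_lincomb !tens_lincomb. Qed.

Lemma annihilates_coordinates {m n p q} (a1 a2 : 'M_(m, p)) (b1 b2 : 'M_(n, q))
    (e : 'I_m -> W1) (h : 'I_n -> W2) (e' : 'I_p -> W1) (h' : 'I_q -> W2) N :
  tensor_injective mu -> lin_indep e' -> lin_indep h' ->
  f1 \o e = lincomb a1 e' -> f2 \o e = lincomb a2 e' ->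
  g1 \o h = lincomb b1 h' -> g2 \o h = lincomb b2 h' ->
  annihilates mu f1 f2 g1 g2 N e h <-> pencil_tensor a1 a2 b1 b2 N = 0.
Proof.
move=> muI ie ih e1 e2 h1 h2; rewrite /annihilates e1 e2 h1 h2 !tens_lincomb//.
split=> [eq12|/eqP]; last by rewrite subr_eq0 => /eqP->.
by apply: (muI _ _ _ _ _ ie ih); rewrite tensB eq12 subrr.
Qed.

End BilinearPencils.

Section NarrowWide.
Context {C : numClosedFieldType} {W1 W2 W3 : lmodType C} (mu : W1 -> W2 -> W3).
Hypothesis mul : forall y, linear (mu^~ y).
Hypothesis mur : forall x, linear (mu x).
Hypothesis muI : tensor_injective mu.
Variables (f1 f2 : {linear W1 -> W1}) (g1 g2 : {linear W2 -> W2}).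

Lemma mu_neq0 x y : mu x y = 0 -> x = 0 \/ y = 0.
Proof.
move=> xy0; have [x0|x0] := pselect (x = 0); [by left|right].
apply: contrapT => y0.
have := muI (M := 1%:M) (lin_indep1 x0) (lin_indep1 y0).
rewrite tens1 big_ord1 => /(_ xy0)/matrixP/(_ 0 0)/eqP.
by rewrite !mxE oner_eq0.
Qed.

(** The relation imposes (n - 1) (n + 1) < n^2 linear conditions on the n x n
matrix of a tensor; its coefficients being independent, a nonzero matrix gives
a nonzero tensor. *)
Lemma narrow_wide_annihilator : narrow_wide_spaces f1 f2 g1 g2 ->
  exists m n (N : 'M_(m, n)) e h,
    tens mu N e h <> 0 /\ annihilates mu f1 f2 g1 g2 N e h.
Proof.
move=> [n [U [U' [n2 _ _]]]].
move=> /constant_rank_coordinates[e [e' [a1 [a2 [ie ie' e1 e2]]]]].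
move=> /constant_rank_coordinates[h [h' [b1 [b2 [ih ih' h1 h2]]]]].
have [|N N0 aN] := lin_ker_neq0 (pencil_tensor a1 a2 b1 b2); first by nia.
exists n, n, N, e, h; split; last first.
  exact/(annihilates_coordinates _ _ _ muI ie' ih' e1 e2 h1 h2).
by move=> /(muI ie ih)/eqP; exact/negP.
Qed.

Hypothesis no_mult : forall x y,
  mu (f1 x) (g2 y) = mu (f2 x) (g1 y) -> x = 0 \/ y = 0.

(** If s <> 0, then f1 x and g1 y are the same multiple of f2 x and g2 y, so the
pure tensor of x and y is an annihilator. *)
Lemma no_common_singularity (s t : C) x y : (s != 0) || (t != 0) ->
  s *: f1 x + t *: f2 x = 0 -> s *: g1 y + t *: g2 y = 0 -> x = 0 \/ y = 0.
Proof.
have solve (V : lmodType C) (a b : C) (u v : V) :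
    a != 0 -> a *: u + b *: v = 0 -> u = (- (a^-1 * b)) *: v.
  move=> a0 /eqP; rewrite addr_eq0 => /eqP /(congr1 (fun w => a^-1 *: w)).
  by rewrite scalerA mulVf// scale1r scalerN scalerA scaleNr.
have muZl c u v : mu (c *: u) v = c *: mu u v by exact: linear_funZ (mul v) _ _.
have muZr c u v : mu u (c *: v) = c *: mu u v by exact: linear_funZ (mur u) _ _.
case/orP => [s0 /(solve _ _ _ _ _ s0) fx /(solve _ _ _ _ _ s0) gy|t0].
  by apply: no_mult; rewrite fx gy muZl muZr.
rewrite addrC => /(solve _ _ _ _ _ t0) fx.
rewrite addrC => /(solve _ _ _ _ _ t0) gy.
by apply: no_mult; rewrite fx gy muZl muZr.
Qed.

Lemma singularities_disjoint {n p q} (e : 'I_n -> W1) (h : 'I_n -> W2)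
    (e' : 'I_p -> W1) (h' : 'I_q -> W2)
    (a1 a2 : 'M_(n, p)) (b1 b2 : 'M_(n, q)) :
  lin_indep e -> lin_indep h ->
  f1 \o e = lincomb a1 e' -> f2 \o e = lincomb a2 e' ->
  g1 \o h = lincomb b1 h' -> g2 \o h = lincomb b2 h' ->
  forall (s t : C) (u v : 'rV_n), (s != 0) || (t != 0) ->
  u *m (s *: a1 + t *: a2) = 0 -> v *m (s *: b1 + t *: b2) = 0 ->
  u = 0 \/ v = 0.
Proof.
move=> ie ih e1 e2 h1 h2 s t u v st ua vb.
have [] := @no_common_singularity s t (lincomb u e 0) (lincomb v h 0) st.
- by rewrite (lincomb_pencil _ _ _ _ e1 e2) ua lincomb0l.
- by rewrite (lincomb_pencil _ _ _ _ h1 h2) vb lincomb0l.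
- by move=> /(lin_indep_row ie); left.
- by move=> /(lin_indep_row ih); right.
Qed.

(** Injectivity of every s g1 + t g2 holds on the whole of W2, and not only on
the span of h, because [no_common_singularity] does: every s f1 + t f2 kills a
nonzero vector of the span of e. *)
Lemma narrow_wide_of_ranks {n} (e : 'I_n -> W1) (h : 'I_n -> W2)
    {y z} (e' : 'I_y -> W1) (h' : 'I_z -> W2)
    (a1 a2 : 'M_(n, y)) (b1 b2 : 'M_(n, z)) :
  (2 <= n)%N -> y = (n - 1)%N -> z = (n + 1)%N ->
  lin_indep e -> lin_indep h -> lin_indep e' -> lin_indep h' ->
  row_full (col_mx a1 a2) -> row_full (col_mx b1 b2) ->
  f1 \o e = lincomb a1 e' -> f2 \o e = lincomb a2 e' ->
  g1 \o h = lincomb b1 h' -> g2 \o h = lincomb b2 h' ->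
  annihilates mu f1 f2 g1 g2 1%:M e h -> narrow_wide f1 f2 g1 g2.
Proof.
move=> n2 yn zn ie ih ie' ih' fa fb e1 e2 h1 h2 rel.
have singular := singularities_disjoint ie ih e1 e2 h1 h2.
have rel' : pencil_tensor a1 a2 b1 b2 1%:M = 0.
  exact/(annihilates_coordinates _ _ _ muI ie' ih' e1 e2 h1 h2).
have ranks := narrow_pencil_ranks n2 fa fb rel' singular yn zn.
split.
- exists n, (lspan (range e)), (lspan (range h)); split=> //.
  + by exists e.
  + by exists h.
  + have := pencil_constant_rank ie ie' fa e1 e2
      (fun s t st => (ranks s t st).1).
    by rewrite yn.
  + have := pencil_constant_rank ih ih' fb h1 h2
      (fun s t st => (ranks s t st).2).
    by rewrite zn.
- have h0 : h (Ordinal (ltnW n2)) <> 0 by exact: lin_indep_neq0.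
  move=> x fx1 fx2; have [//|//] : x = 0 \/ h (Ordinal (ltnW n2)) = 0.
  apply: no_mult; rewrite fx1 fx2.
  by rewrite !(linear_fun0 (mul _)).
- move=> s t st w gw.
  have [u u0 ua] : exists2 u : 'rV_n, u != 0 & u *m (s *: a1 + t *: a2) = 0.
    by apply: row_kernel_neq0; apply: leq_ltn_trans (rank_leq_col _) _; lia.
  have [||/(lin_indep_row ie)/eqP|//] :=
    @no_common_singularity s t (lincomb u e 0) w st.
  + by rewrite (lincomb_pencil _ _ _ _ e1 e2) ua lincomb0l.
  + exact: gw.
  + by rewrite (negPf u0).
Qed.

End NarrowWide.

Section Dichotomy.
Context {C : numClosedFieldType} {W1 W2 W3 : lmodType C} (mu : W1 -> W2 -> W3).
Hypothesis mul : forall y, linear (mu^~ y).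
Hypothesis mur : forall x, linear (mu x).
Hypothesis muI : tensor_injective mu.
Variables (f1 f2 : {linear W1 -> W1}) (g1 g2 : {linear W2 -> W2}).
Hypothesis no_mult : forall x y,
  mu (f1 x) (g2 y) = mu (f2 x) (g1 y) -> x = 0 \/ y = 0.

Definition annihilator {m n} (N : 'M[C]_(m, n)) (e : 'I_m -> W1)
    (h : 'I_n -> W2) : Prop :=
  tens mu N e h <> 0 /\ annihilates mu f1 f2 g1 g2 N e h.

Lemma exists_minimal_annihilator {m n} (N : 'M_(m, n)) e h :
  annihilator N e h ->
  exists r (e' : 'I_r -> W1) (h' : 'I_r -> W2), annihilator 1%:M e' h' /\
  forall p q (M : 'M_(p, q)) e0 h0, annihilator M e0 h0 -> (r <= \rank M)%N.
Proof.
move=> aN; pose P r := `[< exists (e' : 'I_r -> W1) (h' : 'I_r -> W2),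
  annihilator 1%:M e' h' >].
have rankP p q (M : 'M_(p, q)) e0 h0 : annihilator M e0 h0 -> P (\rank M).
  move=> [M0 aM]; apply/asboolP.
  exists (lincomb (col_base M)^T e0), (lincomb (row_base M) h0); split.
    by rewrite -tens_factor.
  by apply/annihilates_lincomb => //; rewrite trmxK mulmx1 mulmx_base.
have exP : exists r, P r by exists (\rank N); exact: rankP aN.
case: (ex_minnP exP) => r /asboolP[e' [h' a1]] minr; exists r, e', h'.
by split=> // p q M e0 h0 /rankP/minr.
Qed.

Lemma minimal_annihilator_indep {n} (e : 'I_n -> W1) (h : 'I_n -> W2) :
  annihilator 1%:M e h ->
  (forall p q (M : 'M_(p, q)) e0 h0, annihilator M e0 h0 -> (n <= \rank M)%N) ->
  lin_indep e /\ lin_indep h.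
Proof.
move=> [eh0 aeh] minn; split; apply: contrapT => /lin_dep_rank_drop[Q Qn QE].
  have /minn : annihilator Q^T e h.
    split; first by rewrite -[Q^T]mulmx1 -tens_lincombl// -QE.
    by rewrite -[Q^T]mulmx1 -[_ *m _]mulmx1; apply/annihilates_lincomb;
       rewrite // -QE lincomb1.
  by rewrite mxrank_tr leqNgt Qn.
have /minn : annihilator Q e h.
  split; first by rewrite -[Q]mul1mx -tens_lincombr// -QE.
  by rewrite -[Q]mul1mx -[1%:M]mulmx1 -{1}trmx1; apply/annihilates_lincomb;
     rewrite // -QE lincomb1.
by rewrite leqNgt Qn.
Qed.

(** The hypothesis [no_mult] excludes annihilators of length one; a minimal
annihilator then falls under the trichotomy of dimensions. *)
Lemma narrow_wide_dichotomy {m n} (N : 'M_(m, n)) e h : annihilator N e h ->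
  narrow_wide f1 f2 g1 g2 \/ narrow_wide g1 g2 f1 f2.
Proof.
move=> /exists_minimal_annihilator{m n N e h}[n [e [h [aeh minn]]]].
have [ie ih] := minimal_annihilator_indep aeh minn; have [eh0 rel] := aeh.
have n_ge2 : (2 <= n)%N.
  case: n e h aeh minn ie ih eh0 rel => [|[|//]] e h _ _ ie ih.
    by rewrite tens1 big_ord0.
  rewrite /annihilates !tens1 !big_ord1 => _ /= /no_mult[] /lin_indep_neq0;
    exact.
have [y [e' [a1 [a2 [ie' fa e1 e2]]]]] := exists_basis2 (f1 \o e) (f2 \o e).
have [z [h' [b1 [b2 [ih' fb h1 h2]]]]] := exists_basis2 (g1 \o h) (g2 \o h).
have coord M := annihilates_coordinates mul mur M muI ie' ih' e1 e2 h1 h2.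
have singular := singularities_disjoint mul mur no_mult ie ih e1 e2 h1 h2.
have rel_unit (M : 'M_n) :
    M != 0 -> pencil_tensor a1 a2 b1 b2 M = 0 -> M \in unitmx.
  move=> M0 /coord aM; rewrite -row_free_unit -row_leq_rank; apply: minn; split.
    by move=> /(muI ie ih)/eqP; exact/negP.
  exact: aM.
have rel' : pencil_tensor a1 a2 b1 b2 1%:M = 0 by exact/coord.
have [[yn zn]|[yn zn]|[yn zn]] := dims_trichotomy n_ge2 fa fb rel' rel_unit.
- left.
  exact: (narrow_wide_of_ranks mul mur muI no_mult) fa fb e1 e2 h1 h2 rel.
- by case: (square_pencils_excluded n_ge2 fa fb rel' singular yn zn).
right; apply: (narrow_wide_of_ranks (mu := fun y x => mu x y))
  fb fa h1 h2 e1 e2 _ => //.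
- exact: tensor_injective_flip.
- by move=> x w eqxw; apply/or_comm; apply: no_mult; rewrite eqxw.
- by apply/annihilates_flip; rewrite trmx1.
Qed.

End Dichotomy.

(** * Bounded functionals on a complex normed space *)

Section RealHahnBanach.
Context {R : realType} {V : lmodType R} (p : V -> R).
Hypothesis pD : forall u v, p (u + v) <= p u + p v.
Hypothesis pZ : forall (t : R) u, 0 <= t -> p (t *: u) = t * p u.

(** A linear relation below p is the graph of a functional: if (u, a) and (u, b)
belong to it, then a - b <= p 0 = 0.  Ordering partial functionals thus becomes
ordering sets by inclusion. *)
Definition dominated_graph (G : set (V * R^o)) : Prop :=
  (forall t u v, G u -> G v -> G (t *: u + v)) /\
  (forall u, G u -> u.2 <= p u.1).

Let p0 : p 0 = 0.
Proof. by rewrite -(scale0r 0) pZ// mul0r. Qed.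

Let scaleRE (a : R) (b : R) : a *: (b : R^o) = a * b :> R. Proof. by []. Qed.

Lemma dominated_line x :
  dominated_graph [set t *: ((x, p x) : V * R^o) | t in setT].
Proof.
split=> [t _ _ [a _ <-] [b _ <-]|_ [t _ <-] /=].
  by exists (t * a + b) => //; rewrite scalerDl scalerA.
have [t0|/ltW t0] := leP 0 t; first by rewrite pZ.
have := pD (t *: x) ((- t) *: x); rewrite -scalerDl subrr scale0r p0.
rewrite (pZ (t := - t)) ?oppr_ge0//.
by rewrite scaleRE mulNr subr_ge0.
Qed.

(** The value c at y has to lie between r - p (u - y) and p (u + y) - r for all
(u, r) in G; these bounds are compatible by subadditivity of p. *)
Lemma dominated_extension G y : dominated_graph G -> G !=set0 ->
  exists c, dominated_graph
    [set g + t *: ((y, c) : V * R^o) | g in G & t in setT].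
Proof.
move=> [Glin Gp] [g0 Gg0].
have G0 : G 0 by rewrite -(addNr g0) -scaleN1r; exact: Glin.
have GZ t g : G g -> G (t *: g).
  by move=> Gg; rewrite -[_ *: _]addr0; exact: Glin.
pose S := [set g.2 - p (g.1 - y) | g in G].
have Sle g g' : G g -> G g' -> g.2 - p (g.1 - y) <= p (g'.1 + y) - g'.2.
  move=> Gg Gg'; have := Glin 1 _ _ Gg Gg'; rewrite scale1r => /Gp/=.
  have := pD (g.1 - y) (g'.1 + y).
  by rewrite addrACA addNr addr0 ?scaleRE/=; lra.
have cS g : G g -> g.2 - p (g.1 - y) <= sup S.
  move=> Gg; apply: ub_le_sup; last by exists g.
  by exists (p (0 + y) - 0) => _ [g' Gg' <-]; exact: Sle Gg' G0.
have cp g : G g -> sup S <= p (g.1 + y) - g.2.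
  move=> Gg; apply: ge_sup; first by exists (g0.2 - p (g0.1 - y)); exists g0.
  by move=> _ [g' Gg' <-]; exact: Sle.
exists (sup S);
  split=> [t _ _ [g Gg [a _ <-]] [g' Gg' [b _ <-]]|_ [g Gg [t _ <-]] /=].
  exists (t *: g + g'); first exact: Glin.
  by exists (t * a + b) => //; rewrite scalerDr scalerDl scalerA addrACA.
have [t0|t0|->] := ltgtP t 0; last first.
- by rewrite !scale0r !addr0; exact: Gp.
- have /= := cp _ (GZ t^-1 _ Gg).
  have -> : g.1 + t *: y = t *: (t^-1 *: g.1 + y).
    by rewrite scalerDr scalerA mulfV ?gt_eqF// scale1r.
  rewrite (pZ _ (ltW t0)) ?scaleRE/= => h.
  have := ler_wpM2l (ltW t0) h; rewrite mulrBr mulrA mulfV ?gt_eqF// mul1r.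
  by lra.
have s0 : 0 < - t by rewrite oppr_gt0.
have /= := cS _ (GZ (- t)^-1 _ Gg).
have -> : g.1 + t *: y = (- t) *: ((- t)^-1 *: g.1 - y).
  by rewrite scalerBr scalerA mulfV ?gt_eqF// scale1r scaleNr opprK.
rewrite (pZ _ (ltW s0)) ?scaleRE/= => h.
have := ler_wpM2l (ltW s0) h; rewrite mulrBr mulrA mulfV ?gt_eqF// mul1r.
by lra.
Qed.

(** A maximal dominated graph is total by [dominated_extension]. *)
Lemma hahn_banach x : exists f : V -> R^o,
  [/\ linear f, (forall u, f u <= p u) & f x = p x].
Proof.
(* Only nonempty graphs need to pass through (x, p x), so that the empty chain
   has an upper bound. *)
pose P G := dominated_graph G /\ (G !=set0 -> G (x, p x)).
have [F FP Ftot|G [[[Glin Gp] Gx] Gmax]] := @Zorn_bigcup _ P.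
  split; [split|].
  - move=> t u v [A FA Au] [B FB Bv].
    have [AB|BA] := Ftot _ _ FA FB.
      by exists B => //; apply: (FP _ FB).1.1 => //; exact: AB.
    by exists A => //; apply: (FP _ FA).1.1 => //; exact: BA.
  - by move=> u [A FA Au]; exact: (FP _ FA).1.2.
  - by move=> [u [A FA Au]]; exists A => //; apply: (FP _ FA).2; exists u.
have Gn0 : G !=set0.
  apply: contrapT => /set0P/negP/negPn/eqP G0.
  apply: (Gmax [set t *: ((x, p x) : V * R^o) | t in setT]).
    rewrite G0; split; first exact: sub0set.
    by move=> sub; apply: (sub ((1 : R) *: ((x, p x) : V * R^o))); exists 1.
  split; first exact: dominated_line.
  by move=> _; exists 1 => //; rewrite scale1r.
have Gfun u a b : G (u, a) -> G (u, b) -> a <= b.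
  move=> Ga Gb; have := Glin (-1) _ _ Gb Ga; rewrite scaleN1r => /Gp/=.
  by rewrite addNr p0; lra.
have Gtot y : exists c, G (y, c).
  have [c cdom] := dominated_extension y (conj Glin Gp) Gn0.
  pose G' := [set g + t *: ((y, c) : V * R^o) | g in G & t in setT].
  have GG' : G `<=` G'.
    by move=> g Gg; exists g => //; exists 0 => //; rewrite scale0r addr0.
  exists c; apply: contrapT => Gyc; apply: (Gmax G').
    split=> // /(_ (y, c)); apply: contra_not Gyc; apply.
    have [g0 Gg0] := Gn0; exists 0.
      by rewrite -(addNr g0) -scaleN1r; exact: Glin.
    by exists 1 => //; rewrite scale1r add0r.
  by split=> // _; apply: GG'; exact: Gx.
have [f Gf] := choice Gtot; exists f; split.
- move=> t u v; have h := Glin t _ _ (Gf u) (Gf v).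
  apply/eqP; rewrite eq_le; apply/andP; split.
    exact: Gfun (Gf _) h.
  exact: Gfun h (Gf _).
- by move=> u; exact: (Gp _ (Gf u)).
- apply/eqP; rewrite eq_le; apply/andP; split.
    exact: Gfun (Gf x) (Gx Gn0).
  exact: Gfun (Gx Gn0) (Gf x).
Qed.

End RealHahnBanach.

(** An alias that carries the structure of real vector space obtained from a
complex one by restriction of scalars. *)
Definition realified (R : rcfType) (V : Type) : Type := V.

Section Realified.
Context {R : rcfType} {V : lmodType R[i]}.
Local Notation VR := (realified R V).

HB.instance Definition _ := GRing.Zmodule.on VR.

Definition realified_scale (a : R) (v : VR) : VR := (a%:C)%C *: (v : V).

Program Definition realified_lmod :=
  @GRing.Zmodule_isLmodule.Build R VR realified_scale _ _ _ _.
Next Obligation. by move=> a b v; rewrite /realified_scale scalerA rmorphM. Qed.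
Next Obligation. by move=> v; rewrite /realified_scale rmorph1 scale1r. Qed.
Next Obligation. by move=> a u v; rewrite /realified_scale scalerDr. Qed.
Next Obligation.
by move=> v a b; rewrite /realified_scale rmorphD scalerDl.
Qed.
HB.instance Definition _ := realified_lmod.

End Realified.

Section BoundedFunctional.
Context {R : realType} {X : normedModType R[i]}.

Definition real_norm (x : X) : R := complex.Re `|x|.

Lemma real_normE (x : X) : (real_norm x)%:C%C = `|x|.
Proof. by rewrite /real_norm RRe_real// ger0_real. Qed.

Lemma real_normD x y : real_norm (x + y) <= real_norm x + real_norm y.
Proof. by rewrite -lecR rmorphD /= !real_normE ler_normD. Qed.

Lemma real_normZ (a : R[i]) x : `|a| = 1 -> real_norm (a *: x) = real_norm x.
Proof. by move=> a1; rewrite /real_norm normrZ a1 mul1r. Qed.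

Lemma real_normZr (t : R) x :
  0 <= t -> real_norm (t%:C%C *: x) = t * real_norm x.
Proof.
move=> t0; apply: (@complexI R); rewrite rmorphM/= !real_normE normrZ.
by rewrite ger0_norm// ler0c.
Qed.

(** The complex functional of real part g is y |-> g y - i g (i y); bounding its
two components separately is enough here and gives the factor 2. *)
Lemma exists_bounded_functional (x : X) : x <> 0 ->
  exists f : X -> R[i]^o,
    [/\ linear f, (forall y, `|f y| <= 2 * `|y|) & f x != 0].
Proof.
move=> /eqP x0.
have [g [glin gp gx]] := @hahn_banach R (realified R X) real_norm real_normD
  real_normZr x.
have glin' a u v : g (a%:C%C *: u + v) = a * g u + g v by exact: glin.
have gD u v : g (u + v) = g u + g v.
  by have := glin' 1 u v; rewrite rmorph1 scale1r mul1r.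
have g0 : g 0 = 0 by have := gD 0 0; rewrite addr0; lra.
have gZ a u : g (a%:C%C *: u) = a * g u.
  by have := glin' a u 0; rewrite g0 !addr0.
have gN u : g (- u) = - g u.
  by apply/eqP; rewrite -addr_eq0 -gD addNr g0.
have gabs u : `|g u| <= real_norm u.
  rewrite ler_norml gp andbT lerNl -gN (le_trans (gp _))//.
  by rewrite /real_norm normrN.
have gC a b u : g ((a +i* b)%C *: u) = a * g u + b * g ('i%C *: u).
  by rewrite (complexE (a +i* b)%C)/= scalerDl gD gZ (mulrC 'i%C) -scalerA gZ.
pose f y : R[i]^o := (g y +i* - g ('i%C *: y))%C.
exists f; split.
- move=> [a b] u v; rewrite /f.
  have -> : 'i%C *: ((a +i* b)%C *: u + v) = ((- b) +i* a)%C *: u + 'i%C *: v.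
    rewrite scalerDr scalerA; congr (_ *: _ + _).
    by apply/eqP; rewrite eq_complex/=; apply/andP; split; apply/eqP; ring.
  rewrite !gD (gC a b) (gC (- b) a); apply/eqP; rewrite eq_complex/=.
  by apply/andP; split; apply/eqP; ring.
- move=> y.
  have -> : f y = (g y)%:C%C - 'i%C * (g ('i%C *: y))%:C%C.
    by rewrite /f [LHS]complexE/= rmorphN mulrN.
  have normC_real (r : R) : `|r%:C%C| = `|r|%:C%C.
    by rewrite normc_def/= expr0n addr0 sqrtr_sqr.
  have normC_i : `|'i%C : R[i]| = 1.
    by rewrite normc_def/= expr0n expr1n add0r sqrtr1.
  rewrite (le_trans (ler_normB _ _))// normrM normC_i mul1r mulrDl mul1r.
  rewrite lerD// normC_real -real_normE lecR ?gabs//.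
  by rewrite -[real_norm y](real_normZ _ normC_i) gabs.
- apply: contra_neq x0 => /eqP; rewrite eq_complex/= gx => /andP[/eqP rx _].
  by apply/eqP; rewrite -normr_eq0 -real_normE rx.
Qed.

End BoundedFunctional.

(** * Coefficients of minimal representations *)

Section TensorUniqueness.
Context {K : fieldType} {W1 W2 W3 : lmodType K} (mu : W1 -> W2 -> W3).
Hypothesis mul : forall y, linear (mu^~ y).
Hypothesis mur : forall x, linear (mu x).
Hypothesis muI : tensor_injective mu.

(** In coordinates the equality is a^T b = a'^T b', where b' has independent
rows, hence a right inverse. *)
Lemma tens_eq_lincombl {m n} (e : 'I_m -> W1) (h : 'I_m -> W2)
    (e' : 'I_n -> W1) (h' : 'I_n -> W2) :
  tens mu 1%:M e h = tens mu 1%:M e' h' -> lin_indep h' ->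
  exists P : 'M_(n, m), e' = lincomb P e.
Proof.
move=> ehE ih'.
have [p [E [a [a' [iE _ eE e'E]]]]] := exists_basis2 e e'.
have [q [H [b [b' [iH _ hH h'H]]]]] := exists_basis2 h h'.
have coord : a^T *m b = a'^T *m b'.
  apply/eqP; rewrite -subr_eq0; apply/eqP/(muI iE iH).
  rewrite tensB -[a^T]mulmx1 -[a'^T]mulmx1 -!tens_lincomb//.
  by rewrite -eE -hH -e'E -h'H ehE subrr.
have /mulmxVp b'V : row_free b'.
  rewrite -row_leq_rank leqNgt; apply/negP => rb.
  have [u u0 ub] := row_kernel_neq0 rb.
  case/eqP: u0; apply: (lin_indep_row ih').
  by rewrite h'H lincombA ub lincomb0l.
exists (b *m pinvmx b')^T.
rewrite e'E eE lincombA; congr lincomb; apply: (can_inj trmxK).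
by rewrite trmx_mul trmxK mulmxA coord -mulmxA b'V mulmx1.
Qed.

(** By [lin_dep_rank_drop], a relation in either family would lower the rank of
the tensor. *)
Lemma tens_min_indep {n} (e : 'I_n -> W1) (h : 'I_n -> W2) :
  (forall m (e' : 'I_m -> W1) (h' : 'I_m -> W2),
     tens mu 1%:M e h = tens mu 1%:M e' h' -> (n <= m)%N) ->
  lin_indep e /\ lin_indep h.
Proof.
move=> minn; split; apply: contrapT => /lin_dep_rank_drop[Q Qn QE].
  have : tens mu 1%:M e h = tens mu Q^T e h.
    by rewrite -[Q^T]mulmx1 -tens_lincombl// -QE.
  by rewrite [in RHS]tens_factor// => /minn; rewrite mxrank_tr leqNgt Qn.
have : tens mu 1%:M e h = tens mu Q e h.
  by rewrite -[Q]mul1mx -tens_lincombr// -QE.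
by rewrite [in RHS]tens_factor// => /minn; rewrite leqNgt Qn.
Qed.

End TensorUniqueness.

(** * Multiplication operators *)

Section Mulop.
Context {K : numFieldType} {X : normedModType K}.
Local Notation LX := (boundedOp X).
Implicit Types A B T : LX.

Lemma boundedOp_scalerAl (a : K) A B : a *: (A * B) = (a *: A) * B.
Proof. exact/val_inj. Qed.

Lemma boundedOp_scalerAr (a : K) A B : a *: (A * B) = A * (a *: B).
Proof.
apply/val_inj/funext => x; apply/esym.
by rewrite -[LHS]/(A (a *: B x)) (linear_funZ (boundedOp_linear A)).
Qed.

Lemma mulop_linearl B : linear ((@mulop K X)^~ B).
Proof.
move=> a A A'; apply/funext => T; rewrite /mulop.
by rewrite !mulrDl -!boundedOp_scalerAl.
Qed.

Lemma mulop_linearr A : linear (@mulop K X A).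
Proof.
move=> a B B'; apply/funext => T; rewrite /mulop.
by rewrite !mulrDr -!boundedOp_scalerAr.
Qed.

Lemma rmulop_linear A : linear (rmulop A).
Proof.
move=> a T T'; rewrite /rmulop /mulop !mul1r.
by rewrite !mulrDl -!boundedOp_scalerAl.
Qed.

Lemma lmulop_linear B : linear (lmulop B).
Proof.
move=> a T T'; rewrite /lmulop /mulop !mulr1.
by rewrite !mulrDr -!boundedOp_scalerAr.
Qed.

HB.instance Definition _ A :=
  GRing.isLinear.Build K LX LX *:%R (rmulop A) (rmulop_linear A).
HB.instance Definition _ B :=
  GRing.isLinear.Build K LX LX *:%R (lmulop B) (lmulop_linear B).

Lemma tens_mulopE {m n} (N : 'M[K]_(m, n)) (e : 'I_m -> LX) (h : 'I_n -> LX) T :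
  tens mulop N e h T = \sum_i \sum_j N i j *: (e i * T * h j).
Proof.
rewrite /tens fct_sumE; apply: eq_bigr => i _.
by rewrite fct_sumE; apply: eq_bigr => j _.
Qed.

(** Composing multiplication operators multiplies the left coefficients on the
right and the right coefficients on the left. *)
Lemma tens_mulop_comp {m n} (N : 'M[K]_(m, n)) (e : 'I_m -> LX) (h : 'I_n -> LX)
    (A1 A2 B1 B2 : LX) :
  tens mulop N e h \o (mulop A1 B1 + mulop A2 B2) = 0 <->
  annihilates mulop (rmulop A1) (rmulop A2) (lmulop (- B2)) (lmulop B1) N e h.
Proof.
rewrite /annihilates.
have -> : tens mulop N e h \o (mulop A1 B1 + mulop A2 B2) =
    tens mulop N (rmulop A1 \o e) (lmulop B1 \o h) -
    tens mulop N (rmulop A2 \o e) (lmulop (- B2) \o h).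
  apply/funext => T.
  rewrite -[LHS]/(tens mulop N e h (A1 * T * B1 + A2 * T * B2)).
  rewrite -[RHS]/(_ T - _ T) !tens_mulopE -sumrB; apply: eq_bigr => i _.
  rewrite -sumrB; apply: eq_bigr => j _.
  rewrite -scalerBr; congr (_ *: _); rewrite /= /rmulop /lmulop /mulop.
  by rewrite !mul1r !mulr1 mulNr mulrN opprK mulrDr mulrDl !mulrA.
by split=> [/eqP|->]; rewrite ?subr_eq0 ?subrr// => /eqP.
Qed.

End Mulop.

Section RankOne.
Context {R : realType} {X : normedModType R[i]}.
Local Notation LX := (boundedOp X).

Lemma exists_rank_one (f : X -> R[i]^o) (y : X) :
  linear f -> (exists M, forall x, `|f x| <= M * `|x|) ->
  exists T : LX, forall x, T x = f x *: y.
Proof.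
move=> fl [M fM].
have TP : (fun x => f x *: y) \in @bounded_linear _ X.
  apply/asboolP; split=> [a u v|]; first by rewrite fl scalerDl -scalerA.
  by exists (M * `|y|) => x; rewrite normrZ mulrAC ler_wpM2r.
by exists (BoundedOp TP).
Qed.

(** Evaluate the operator at a rank one T = f (-) y and then at x: independence
of the e_i gives f (sum_j N_ij h_j x) = 0 for all i, f and x, hence
sum_j N_ij h_j = 0 since bounded functionals separate points. *)
Lemma mulop_tensor_injective : tensor_injective (@mulop _ X).
Proof.
move=> m n N e h ie ih Nz; apply/matrixP => i j; rewrite mxE.
suff rowz : lincomb N h i = 0 by exact: ih rowz j.
apply/val_inj/funext => x; apply: contrapT => /exists_bounded_functional.
move=> [f [fl fM /eqP]]; apply.
have fs (I : finType) (c : I -> R[i]) (v : I -> X) :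
    f (\sum_k c k *: v k) = \sum_k c k * f (v k).
  have f0 : f 0 = 0 by exact: linear_fun0 fl.
  by elim/big_rec2: _ => [|k u w _ <-]; rewrite ?fl ?f0.
have opE p (c : 'I_p -> R[i]) (v : 'I_p -> LX) z :
    (\sum_k c k *: v k : LX) z = \sum_k c k *: v k z.
  by elim/big_rec2: _ => [//|k u w _ <-].
apply: (ie (fun k => f (lincomb N h k x)) _ i).
apply/val_inj/funext => y; rewrite [LHS]opE.
have [T TE] := exists_rank_one y fl (ex_intro _ 2 fM).
have /(congr1 (fun F : LX -> LX => F T x)) := Nz.
rewrite tens_mulopE => Nz'; apply: etrans Nz'.
have opS p (v : 'I_p -> LX) z : (\sum_k v k : LX) z = \sum_k v k z.
  by elim/big_rec2: _ => [//|k u w _ <-].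
rewrite opS; apply: eq_bigr => k _; rewrite opE opE fs scaler_suml.
apply: eq_bigr => l _; rewrite -scalerA.
have lin (A : LX) a z : A (a *: z) = a *: A z.
  exact: linear_funZ (boundedOp_linear A) _ _.
by rewrite -[(e k * T * h l) x]/(e k (T (h l x))) TE lin.
Qed.

End RankOne.

Section CoefficientSpaces.
Context {R : realType} {X : normedModType R[i]}.
Local Notation LX := (boundedOp X).
Variables (Psi : LX -> LX) (n : nat) (A B : 'I_n -> LX).
Hypothesis Psi_n : has_length Psi n.
Hypothesis PsiE : Psi = sum_mulop A B.

Let mul := @mulop_linearl _ X.
Let mur := @mulop_linearr _ X.
Let muI := @mulop_tensor_injective _ X.

Lemma sum_mulop_tens m (A' B' : 'I_m -> LX) :
  sum_mulop A' B' = tens mulop 1%:M A' B'.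
Proof. by rewrite tens1. Qed.

Lemma min_length_indep m (A' B' : 'I_m -> LX) :
  has_length Psi m -> Psi = sum_mulop A' B' -> lin_indep A' /\ lin_indep B'.
Proof.
move=> [_ minm] E'; apply: (tens_min_indep mul mur (mu := mulop)).
by move=> k A0 B0; rewrite -!sum_mulop_tens -E' => /minm.
Qed.

(** The space does not depend on the chosen minimal representation. *)
Lemma left_spaceE : left_space Psi = lspan (range A).
Proof.
apply/seteqP; split=> [T [m [A' [B' [lm E' AT]]]]|T AT]; last by exists n, A, B.
have [_ iB'] := min_length_indep lm E'.
have [P PE] : exists P, A' = lincomb P A.
  apply: (tens_eq_lincombl mul mur muI (h := B) _ iB').
  by rewrite -!sum_mulop_tens -PsiE.
by move: AT; rewrite PE; exact: lspan_lincomb.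
Qed.

Lemma right_spaceE : right_space Psi = lspan (range B).
Proof.
apply/seteqP; split=> [T [m [A' [B' [lm E' BT]]]]|T BT]; last by exists n, A, B.
have [iA' _] := min_length_indep lm E'.
have [P PE] : exists P, B' = lincomb P B.
  apply: (tens_eq_lincombl (mu := fun y x => mulop x y) mur mul _ (h := A)
    _ iA').
    exact: tensor_injective_flip.
  rewrite -{1}trmx1 tens_flip -[in RHS]trmx1 tens_flip.
  by rewrite -!sum_mulop_tens -PsiE.
by move: BT; rewrite PE; exact: lspan_lincomb.
Qed.

End CoefficientSpaces.

(** * Elementary operators of length two *)

Section LengthTwo.
Context {R : realType} {X : normedModType R[i]}.
Local Notation LX := (boundedOp X).
Variables (Psi : LX -> LX) (A B : 'I_2 -> LX).
Hypothesis Psi_len2 : has_length Psi 2.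
Hypothesis PsiE : Psi = sum_mulop A B.

Let f1 := rmulop (A 0).
Let f2 := rmulop (A 1).
Let g1 := lmulop (- B 1).
Let g2 := lmulop (B 0).

Lemma left_space2 T :
  left_space Psi T <-> exists s t : R[i], T = s *: A 0 + t *: A 1.
Proof. by rewrite (left_spaceE Psi_len2 PsiE) lspan_range2. Qed.

Lemma right_space2 T :
  right_space Psi T <-> exists s t : R[i], T = s *: B 0 + t *: B 1.
Proof. by rewrite (right_spaceE Psi_len2 PsiE) lspan_range2. Qed.

Lemma rmulop_pencil (s t : R[i]) :
  rmulop (s *: A 0 + t *: A 1) = (fun T => s *: f1 T + t *: f2 T).
Proof.
apply/funext => T; rewrite /f1 /f2 /rmulop /mulop !mul1r mulrDr.
by rewrite -!boundedOp_scalerAr.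
Qed.

Lemma lmulop_pencil (s t : R[i]) :
  lmulop (s *: B 0 + t *: B 1) = (fun T => (- t) *: g1 T + s *: g2 T).
Proof.
apply/funext => T; rewrite /g1 /g2 /lmulop /mulop !mulr1 mulrDl addrC.
by rewrite mulNr scaleNr scalerN opprK -!boundedOp_scalerAl.
Qed.

Lemma left_pencil : [set rmulop A' | A' in left_space Psi] = pencil f1 f2.
Proof.
apply/seteqP; split=> [_ [T /left_space2[s [t ->]] <-]|_ [s [t ->]]].
  by exists s, t; rewrite rmulop_pencil.
exists (s *: A 0 + t *: A 1); last by rewrite rmulop_pencil.
by apply/left_space2; exists s, t.
Qed.

Lemma right_pencil : [set lmulop B' | B' in right_space Psi] = pencil g1 g2.
Proof.
apply/seteqP; split=> [_ [T /right_space2[s [t ->]] <-]|_ [s [t ->]]].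
  by exists (- t), s; rewrite lmulop_pencil.
exists (t *: B 0 + (- s) *: B 1); last by rewrite lmulop_pencil opprK.
by apply/right_space2; exists t, (- s).
Qed.

Lemma left_pencil_image (U : set LX) :
  lspan [set E * A' | A' in left_space Psi & E in U] = pencil_image f1 f2 U.
Proof.
rewrite /pencil_image -left_pencil; congr lspan.
apply/seteqP; split=> [_ [A' lA [E UE <-]]|_ [_ [A' lA <-] [E UE <-]]].
  exists (rmulop A'); first by exists A'.
  by exists E => //; rewrite /rmulop /mulop mul1r.
by exists A' => //; exists E => //; rewrite /rmulop /mulop mul1r.
Qed.

Lemma right_pencil_image (V : set LX) :
  lspan [set B' * F | B' in right_space Psi & F in V] = pencil_image g1 g2 V.
Proof.
rewrite /pencil_image -right_pencil; congr lspan.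
apply/seteqP; split=> [_ [B' rB [F VF <-]]|_ [_ [B' rB <-] [F VF <-]]].
  exists (lmulop B'); first by exists B'.
  by exists F => //; rewrite /lmulop /mulop mulr1.
by exists B' => //; exists F => //; rewrite /lmulop /mulop mulr1.
Qed.

Lemma tens_mulop_comp_Psi {m n} (N : 'M[R[i]]_(m, n)) (e : 'I_m -> LX)
    (h : 'I_n -> LX) :
  tens mulop N e h \o Psi = 0 <-> annihilates mulop f1 f2 g1 g2 N e h.
Proof.
rewrite -tens_mulop_comp PsiE /sum_mulop big_ord_recl big_ord1.
by have -> : lift ord0 ord0 = 1 :> 'I_2 by exact/val_inj.
Qed.

Lemma left_kernel : (forall T, f1 T = 0 -> f2 T = 0 -> T = 0) ->
  Lann (left_space Psi) = [set 0].
Proof.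
move=> inj; apply/seteqP; split=> [T TA|_ -> U _]; last by rewrite mul0r.
have fE A' : T * A' = rmulop A' T by rewrite /rmulop /mulop mul1r.
apply: inj; rewrite /f1 /f2 -fE; apply: TA; apply/left_space2.
  by exists 1, 0; rewrite scale1r scale0r addr0.
by exists 0, 1; rewrite scale1r scale0r add0r.
Qed.

Lemma right_kernel : (forall T, g1 T = 0 -> g2 T = 0 -> T = 0) ->
  Rann (right_space Psi) = [set 0].
Proof.
move=> inj; apply/seteqP; split=> [T BT|_ -> U _]; last by rewrite mulr0.
have gE B' : B' * T = lmulop B' T by rewrite /lmulop /mulop mulr1.
apply: inj; rewrite /g1 /g2 -gE; apply: BT; apply/right_space2.
  by exists 0, (-1); rewrite scaleN1r scale0r add0r.
by exists 1, 0; rewrite scale1r scale0r addr0.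
Qed.

Lemma left_injective :
  (forall s t : R[i], (s != 0) || (t != 0) ->
     forall T, s *: f1 T + t *: f2 T = 0 -> T = 0) ->
  forall A', left_space Psi A' -> A' <> 0 -> injective (rmulop A').
Proof.
move=> inj A' /left_space2[s [t AE]] A0 T T' eqT; apply/eqP; rewrite -subr_eq0.
apply/eqP/(inj s t).
  apply: contra_notT A0; rewrite negb_or !negbK => /andP[/eqP s0 /eqP t0].
  by rewrite AE s0 t0 !scale0r addr0.
rewrite -[LHS]/((fun T => s *: f1 T + t *: f2 T) _) -rmulop_pencil -AE.
by rewrite linearB/= eqT subrr.
Qed.

Lemma right_injective :
  (forall s t : R[i], (s != 0) || (t != 0) ->
     forall T, s *: g1 T + t *: g2 T = 0 -> T = 0) ->
  forall B', right_space Psi B' -> B' <> 0 -> injective (lmulop B').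
Proof.
move=> inj B' /right_space2[s [t BE]] B0 T T' eqT; apply/eqP; rewrite -subr_eq0.
apply/eqP/(inj (- t) s).
  apply: contra_notT B0; rewrite negb_or !negbK oppr_eq0.
  move=> /andP[/eqP t0 /eqP s0].
  by rewrite BE s0 t0 !scale0r addr0.
rewrite -[LHS]/((fun T => (- t) *: g1 T + s *: g2 T) _) -lmulop_pencil -BE.
by rewrite linearB/= eqT subrr.
Qed.

Lemma exists_annihilator_of_tens {m n} (N : 'M[R[i]]_(m, n)) (e : 'I_m -> LX)
    (h : 'I_n -> LX) :
  tens mulop N e h <> 0 -> annihilates mulop f1 f2 g1 g2 N e h ->
  exists Chi : LX -> LX, [/\ is_elementary Chi, Chi <> 0 & Chi \o Psi = 0].
Proof.
move=> N0 aN; exists (tens mulop N e h); split=> //;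
  last exact/tens_mulop_comp_Psi.
rewrite (tens_factor (@mulop_linearl _ X) (@mulop_linearr _ X)).
by eexists _, _, _; rewrite -sum_mulop_tens.
Qed.

End LengthTwo.

Unset Implicit Arguments.

Theorem theorem9 (R : realType) (X : completeNormedModType R[i])
    (Psi : boundedOp X -> boundedOp X) (Psi_len2 : has_length Psi 2) :
  (exists Chi : boundedOp X -> boundedOp X,
     [/\ is_elementary Chi, Chi <> 0 & Chi \o Psi = 0])
  <->
  [\/ exists M : boundedOp X -> boundedOp X,
        [/\ is_mulop M, M <> 0 & M \o Psi = 0],
      (exists (n : nat) (U V : set (boundedOp X)),
        [/\ (2 <= n)%N, subspace_of_dim n U, subspace_of_dim n V,
            equivalent_to_constant_rank V
              (lspan [set B * F | B in right_space Psi & F in V])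
              [set lmulop B | B in right_space Psi]
              (n - 1) (n - 1) n
          & equivalent_to_constant_rank U
              (lspan [set E * A | A in left_space Psi & E in U])
              [set rmulop A | A in left_space Psi]
              n (n + 1) n])
      /\ Rann (right_space Psi) = [set 0]
      /\ (forall A, left_space Psi A -> A <> 0 -> injective (rmulop A))
    | (exists (n : nat) (U V : set (boundedOp X)),
        [/\ (2 <= n)%N, subspace_of_dim n U, subspace_of_dim n V,
            equivalent_to_constant_rank V
              (lspan [set B * F | B in right_space Psi & F in V])
              [set lmulop B | B in right_space Psi]
              n (n + 1) n
          & equivalent_to_constant_rank U
              (lspan [set E * A | A in left_space Psi & E in U])
              [set rmulop A | A in left_space Psi]
              (n - 1) (n - 1) n])
      /\ Lann (left_space Psi) = [set 0]
      /\ (forall B, right_space Psi B -> B <> 0 -> injective (lmulop B))].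
Proof.
have [[A [B PsiE]] _] := Psi_len2.
pose mul := @mulop_linearl _ X; pose mur := @mulop_linearr _ X.
pose muI := @mulop_tensor_injective _ X.
have compE m n := @tens_mulop_comp_Psi _ _ _ _ _ PsiE m n.
set f1 := rmulop (A 0) in compE; set f2 := rmulop (A 1) in compE.
set g1 := lmulop (- B 1) in compE; set g2 := lmulop (B 0) in compE.
have mulop_tens x y : mulop x y = tens mulop 1%:M (fun=> x) (fun _ : 'I_1 => y).
  by rewrite tens1 big_ord1.
rewrite (left_pencil Psi_len2 PsiE) (right_pencil Psi_len2 PsiE).
split=> [[Chi [[n [E [F ChiE]]] Chi0 ChiPsi]]|].
  have [|noM] := pselect (exists M : boundedOp X -> boundedOp X,
    [/\ is_mulop M, M <> 0 & M \o Psi = 0]); first by move=> hM; apply: Or31.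
  have no_mult x y :
      mulop (f1 x) (g2 y) = mulop (f2 x) (g1 y) -> x = 0 \/ y = 0.
    move=> rel; apply: (mu_neq0 muI); apply: contrapT => xy0; apply: noM.
    exists (mulop x y); split=> //; first by exists x, y.
    by rewrite mulop_tens; apply/compE; rewrite /annihilates !tens1 !big_ord1.
  rewrite sum_mulop_tens in ChiE; rewrite ChiE in Chi0 ChiPsi.
  have [] := narrow_wide_dichotomy mul mur muI no_mult
    (conj Chi0 ((compE _ _ _ _ _).1 ChiPsi)).
  - move=> [[k [U [V [k2 dU dV narrow wide]]]] fker ginj]; apply: Or33.
    split; last split; last exact: (right_injective Psi_len2 PsiE ginj).
      exists k, U, V; split=> //.
        by rewrite (right_pencil_image Psi_len2 PsiE).
      by rewrite (left_pencil_image Psi_len2 PsiE).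
    exact: (left_kernel Psi_len2 PsiE fker).
  move=> [[k [V [U [k2 dV dU narrow wide]]]] gker finj]; apply: Or32.
  split; last split; last exact: (left_injective Psi_len2 PsiE finj).
    exists k, U, V; split=> //.
      by rewrite (right_pencil_image Psi_len2 PsiE).
    by rewrite (left_pencil_image Psi_len2 PsiE).
  exact: (right_kernel Psi_len2 PsiE gker).
case=> [[M [[x [y ->]] M0 MPsi]]|[[n [U [V [n2 dU dV + +]]]] _]
        |[[n [U [V [n2 dU dV + +]]]] _]].
- exists (mulop x y); split=> //.
  by exists 1%N, (fun=> x), (fun=> y); rewrite sum_mulop_tens -mulop_tens.
- rewrite (right_pencil_image Psi_len2 PsiE) (left_pencil_image Psi_len2 PsiE).
  move=> narrow wide.
  have nw : narrow_wide_spaces g1 g2 f1 f2 by exists n, V, U.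
  have [m [k [N [e [h [N0 aN]]]]]] :=
    narrow_wide_annihilator (mu := fun y x => mulop x y)
    mur mul (tensor_injective_flip muI) nw.
  apply: (exists_annihilator_of_tens PsiE (N := N^T) (e := h) (h := e)).
    by rewrite -(tens_flip mulop) trmxK.
  by apply/annihilates_flip; rewrite trmxK.
rewrite (right_pencil_image Psi_len2 PsiE) (left_pencil_image Psi_len2 PsiE).
move=> wide narrow.
have nw : narrow_wide_spaces f1 f2 g1 g2 by exists n, U, V.
have [m [k [N [e [h [N0 aN]]]]]] := narrow_wide_annihilator mul mur muI nw.
exact: (exists_annihilator_of_tens PsiE N0 aN).
Qed.
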